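(* Let $\mathcal{M}=(S,A,AP,L,I)$ be an interval Markov decision process and let $s,t\in S$ with $s\sim_{(\exists\pi\forall)} t$. Then for every PCTL state formula $\varphi$ we have $s\models_{(\exists\pi\forall)}\varphi$ if and only if $t\models_{(\exists\pi\forall)}\varphi$.
   Context: An interval MDP (IMDP) is a tuple $(S,A,AP,L,I)$ with $S$ a finite set of states, $A$ a finite set of actions, $AP$ a finite set of atomic propositions, $L:S\to 2^{AP}$ a labelling, and $I:S\times A\times S\to\mathbb{I}$ where $\mathbb{I}$ is a set of subintervals of $[0,1]$. For $s\in S,a\in A$, write $s\xrightarrow{a}\mu$ if $\mu$ is a probability distribution on $S$ with $\mu(s')\in I(s,a,s')$ for all $s'$; the set $\Gamma_{s,a}=\{\mu\mid s\xrightarrow{a}\mu\}$ is required to be non-empty. A scheduler is a function $\sigma$ from finite paths to distributions over $A$; a nature is a function $\pi$ mapping a finite path $\omega$ and action $a$ to an element of $\Gamma_{\mathrm{last}(\omega),a}$, where $\mathrm{last}(\omega)$ is the last state of $\omega$. $\Sigma,\Pi$ denote the sets of all schedulers and natures. $\Pr^{\sigma,\pi}_s$ is the unique probability measure on infinite paths (cylinder $\sigma$-algebra) with the one-state cylinder of $s'$ having probability $1$ iff $s'=s$ (else $0$), and $\Pr^{\sigma,\pi}_s[\mathrm{Cyl}(\omega s')]=\Pr^{\sigma,\pi}_s[\mathrm{Cyl}(\omega)]\cdot\sum_{a}\sigma(\omega)(a)\pi(\omega,a)(s')$. PCTL: state formulas $\varphi::=\mathit{true}\mid x\mid\neg\varphi\mid\varphi_1\wedge\varphi_2\mid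 \mathsf{P}_{\bowtie p}(\psi)$, path formulas $\psi::=\mathsf{X}\varphi\mid\varphi_1\mathsf{U}\varphi_2\mid\varphi_1\mathsf{U}^{\le k}\varphi_2$ ($x\in AP$, rational $p\in[0,1]$, $\bowtie\in\{\le,<,\ge,>\}$, $k\in\mathbb{N}$). The relation $\models_{(\exists\pi\forall)}$: $s\models x$ iff $x\in L(s)$; negation, conjunction as usual; $s\models_{(\exists\pi\forall)}\mathsf{P}_{\bowtie p}(\psi)$ iff there exists $\pi\in\Pi$ such that for all $\sigma\in\Sigma$, $\Pr^{\sigma,\pi}_s[\{\omega\mid\omega\models_{(\exists\pi\forall)}\psi\}]\bowtie p$. For $\omega=s_1s_2\cdots$: $\omega\models\mathsf{X}\varphi$ iff $s_2\models\varphi$; $\omega\models\varphi_1\mathsf{U}^{\le k}\varphi_2$ iff some $i\le k$ has $s_i\models\varphi_2$ and $s_j\models\varphi_1$ for all $j<i$; $\omega\models\varphi_1\mathsf{U}\varphi_2$ iff $\omega\models\varphi_1\mathsf{U}^{\le k}\varphi_2$ for some $k$. For a family $(\mu_a)_{a\in A}$ of distributions write $s\xrightarrow{(\mu_a)}\mu$ if there is $\rho\in\mathrm{Dist}(A)$ with $\mu=\sum_a\rho(a)\mu_a$. An equivalence relation $R\subseteq S\times S$ is a probabilistic $(\exists\pi\forall)$-bisimulation if for all $(s,t)\in R$: $L(s)=L(t)$, and for each $(\mu_a)_{a\in A}$ with $s\xrightarrow{a}\mu_a$ for all $a$ there is $(\nu_a)_{a\in A}$ with $t\xrightarrow{a}\nu_a$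 for all $a$ such that for each $t\xrightarrow{(\nu_a)}\nu$ there is $s\xrightarrow{(\mu_a)}\mu$ with $\mu(C)=\nu(C)$ for every equivalence class $C$ of $R$. $s\sim_{(\exists\pi\forall)}t$ iff some such bisimulation contains $(s,t)$. *)

(* Defs.v *)
From HB Require Import structures.
From mathcomp Require Import all_boot all_order all_algebra.
From mathcomp Require Import all_classical all_reals all_analysis.
Set Implicit Arguments. Unset Strict Implicit. Unset Printing Implicit Defensive.
Import Order.TTheory GRing.Theory Num.Theory.
Local Open Scope classical_set_scope.
Local Open Scope ring_scope.

Section IMDP.
Variables (R : realType) (S A AP : finType).

Definition isDist (T : finType) (mu : T -> R) : Prop :=
  (forall x, 0 <= mu x) /\ \sum_(x : T) mu x = 1.

Record imdp := IMDP {
  lab : S -> {set AP};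
  itv : S -> A -> S -> interval R;
  itv_sub01 : forall s a s' (x : R), x \in itv s a s' -> 0 <= x <= 1;
  gamma_nonempty : forall s a, exists mu : S -> R,
      isDist mu /\ forall s', mu s' \in itv s a s'
}.

Variable M : imdp.

Definition Gamma (s : S) (a : A) (mu : S -> R) : Prop :=
  isDist mu /\ forall s', mu s' \in itv M s a s'.

(** finite paths (non-empty): (s_1, [:: s_2; ...; s_n]) *)
Definition fpath := (S * seq S)%type.
Definition fseq (w : fpath) : seq S := w.1 :: w.2.
Definition flast (w : fpath) : S := last w.1 w.2.
Definition fext (w : fpath) (s' : S) : fpath := (w.1, rcons w.2 s').

(** infinite paths s_1 s_2 ... represented as nat -> S, position i (1-based)
    is [pos w i = w (i-1)] *)
Definition ipath := (nat -> S).
Definition pos (w : ipath) (i : nat) : S := w i.-1.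

Definition Cyl (w : fpath) : set ipath :=
  [set x | forall i, (i < size (fseq w))%N -> x i = nth w.1 (fseq w) i].

Definition cylinders : set (set ipath) := [set Cyl w | w in [set: fpath]].

Definition cyl_measurable : set (set ipath) := <<s cylinders >>.

(** P is a probability measure on the cylinder sigma-algebra
    (the measure axioms of MathComp-Analysis, written out for this
    sigma-algebra) *)
Definition is_prob_measure (P : set ipath -> \bar R) : Prop :=
  [/\ P set0 = 0%E,
      forall X, cyl_measurable X -> (0 <= P X)%E,
      (forall F : nat -> set ipath, (forall n, cyl_measurable (F n)) ->
          trivIset setT F ->
          (fun n => \sum_(0 <= i < n) P (F i))%E @ \oo --> P (\bigcup_n F n))
    & P setT = 1%E].

Definition is_scheduler (sg : fpath -> A -> R) : Prop :=
  forall w, isDist (sg w).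

Definition is_nature (pi : fpath -> A -> S -> R) : Prop :=
  forall w a, Gamma (flast w) a (pi w a).

(** P is the (unique) measure Pr^{sg,pi}_s *)
Definition is_Pr (sg : fpath -> A -> R) (pi : fpath -> A -> S -> R) (s : S)
    (P : set ipath -> \bar R) : Prop :=
  [/\ is_prob_measure P,
      (forall s', P (Cyl (s', [::])) = (if s' == s then 1 else 0)%:E)
    & (forall w s', P (Cyl (fext w s')) =
          (P (Cyl w) * (\sum_(a : A) sg w a * pi w a s')%:E)%E)].

Inductive cmp := CLe | CLt | CGe | CGt.

Definition cmpE (c : cmp) (x y : \bar R) : Prop :=
  match c with
  | CLe => (x <= y)%E | CLt => (x < y)%E | CGe => (y <= x)%E | CGt => (y < x)%E
  end.

Inductive sform :=
  | STrue
  | SAtom of AP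
  | SNeg of sform
  | SAnd of sform & sform
  | SProb of cmp & rat & pform
with pform :=
  | PNext of sform
  | PUntil of sform & sform
  | PBUntil of sform & sform & nat.

Fixpoint wf_sform (f : sform) : Prop :=
  match f with
  | STrue | SAtom _ => True
  | SNeg g => wf_sform g
  | SAnd g h => wf_sform g /\ wf_sform h
  | SProb _ p psi => (0 <= p <= 1)%R /\ wf_pform psi
  end
with wf_pform (g : pform) : Prop :=
  match g with
  | PNext f => wf_sform f
  | PUntil f h => wf_sform f /\ wf_sform h
  | PBUntil f h _ => wf_sform f /\ wf_sform h
  end.

(** w |= phi1 U^{<=k} phi2 (positions 1-based, as in the paper) *)
Definition bounded_until (P1 P2 : S -> Prop) (k : nat) (w : ipath) : Prop :=
  exists i, [/\ (1 <= i <= k)%N, P2 (pos w i)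
                & forall j, (1 <= j < i)%N -> P1 (pos w j)].

Fixpoint sat (f : sform) (s : S) {struct f} : Prop :=
  match f with
  | STrue => True
  | SAtom x => x \in lab M s
  | SNeg g => ~ sat g s
  | SAnd g h => sat g s /\ sat h s
  | SProb c p psi =>
      exists pi, is_nature pi /\
        forall sg, is_scheduler sg ->
          forall P, is_Pr sg pi s P ->
            cmpE c (P [set w | psat psi w]) (ratr p)%:E
  end
with psat (g : pform) (w : ipath) {struct g} : Prop :=
  match g with
  | PNext f => sat f (pos w 2)
  | PBUntil f h k => bounded_until (sat f) (sat h) k w
  | PUntil f h => exists k, bounded_until (sat f) (sat h) k w
  end.

Definition mixes (fam : A -> S -> R) (mu : S -> R) : Prop :=
  exists rho : A -> R, isDist rho /\ forall x, mu x = \sum_(a : A) rho a * fam a x.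

Definition is_bisim (Rel : rel S) : Prop :=
  [/\ reflexive Rel, symmetric Rel, transitive Rel &
   forall s t, Rel s t ->
     lab M s = lab M t /\
     forall mus : A -> S -> R, (forall a, Gamma s a (mus a)) ->
       exists nus : A -> S -> R, (forall a, Gamma t a (nus a)) /\
         forall nu, mixes nus nu ->
           exists mu, mixes mus mu /\
             forall c : S, \sum_(u | Rel c u) mu u = \sum_(u | Rel c u) nu u].

Definition bisimilar (s t : S) : Prop :=
  exists Rel : rel S, is_bisim Rel /\ Rel s t.

End IMDP.

(* Main.v *)
Require Import Defs.
From HB Require Import structures.
From mathcomp Require Import all_boot all_order all_algebra.
From mathcomp Require Import all_classical all_reals all_analysis.
From mathcomp Require Import lra.
Set Implicit Arguments. Unset Strict Implicit. Unset Printing Implicit Defensive.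
Import Order.TTheory GRing.Theory Num.Theory.
Local Open Scope classical_set_scope.
Local Open Scope ring_scope.

(** By induction on the formula all subformulas define unions of bisimulation
    classes, so it suffices to transfer "nature can enforce that the
    probability of a path event compares to [p]" from [s] to a bisimilar [t].

    Simulation.  A nature at [t] follows a nature at [s] by answering each
    family of the latter with the family given by the bisimulation, and, after
    a move into a class, continuing as if [s] had moved to the state of that
    class that is best for nature.  This never increases the supremum, over
    schedulers, of the probability of a finite-horizon or until event, and it
    never decreases the infimum for a finite horizon.  For a finite horizon
    schedulers attain both extrema, which settles next and bounded until.  For
    until, [<=] follows in the same way, and [>] reduces to a finite horizon
    because the infimum over schedulers is the limit of its finite-horizon
    versions and is attained.

    Until, [<].  Greedy schedulers for discounted value iteration are
    positional, and as there are finitely many of them, one value below [p]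
    bounds them all.  Hence the value of the game is below [p], nature has a
    strategy with supremum below [p], and that strategy is simulated.

    Until, [>=].  Intervals need not be closed, so nature may or may not have an
    optimal strategy.  The states where it has one are contained in an attractor
    defined by families that do not decrease the optimal value and, whenever
    they preserve it, make progress with positive probability; the attractor
    is a union of classes, and playing these families is optimal on it. *)

(** * Expectations on a finite state space *)

Section Expectation.
Variables (R : realType) (S : finType).
Implicit Types (mu nu f g : S -> R).

Definition expect mu f : R := \sum_x mu x * f x.

Lemma expect_le mu f g :
  isDist mu -> (forall x, f x <= g x) -> expect mu f <= expect mu g.
Proof. by move=> [mu0 _] fg; apply: ler_sum => x _; rewrite ler_wpM2l. Qed.

Lemma expect_eq mu f g : f =1 g -> expect mu f = expect mu g.
Proof. by move=> fg; apply: eq_bigr => x _; rewrite fg. Qed.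

Lemma expect_cst mu c : isDist mu -> expect mu (fun=> c) = c.
Proof. by move=> [_ mu1]; rewrite /expect -mulr_suml mu1 mul1r. Qed.

Lemma expectD mu f g :
  expect mu (fun x => f x + g x) = expect mu f + expect mu g.
Proof. by rewrite /expect -big_split; apply: eq_bigr => x _; rewrite mulrDr. Qed.

Lemma expectB mu f g :
  expect mu (fun x => f x - g x) = expect mu f - expect mu g.
Proof. by rewrite /expect -sumrB; apply: eq_bigr => x _; rewrite mulrBr. Qed.

Lemma expectZ mu f c : expect mu (fun x => c * f x) = c * expect mu f.
Proof. by rewrite /expect mulr_sumr; apply: eq_bigr => x _; rewrite mulrCA. Qed.

Lemma expect_ge0 mu f : isDist mu -> (forall x, 0 <= f x) -> 0 <= expect mu f.
Proof.
by move=> Dmu f0; rewrite -[leLHS](expect_cst 0 Dmu); apply: expect_le.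
Qed.

Lemma expect_le1 mu f : isDist mu -> (forall x, f x <= 1) -> expect mu f <= 1.
Proof.
by move=> Dmu f1; rewrite -[leRHS](expect_cst 1 Dmu); apply: expect_le.
Qed.

Lemma expect_leD mu f g c : isDist mu ->
  (forall x, f x <= g x + c) -> expect mu f <= expect mu g + c.
Proof.
by move=> Dmu fg; rewrite -[X in _ + X](expect_cst c Dmu) -expectD; apply: expect_le.
Qed.

Lemma expect_le_supp mu f g : isDist mu ->
  (forall x, 0 < mu x -> f x <= g x) -> expect mu f <= expect mu g.
Proof.
move=> [mu0 _] fg; apply: ler_sum => x _.
have := mu0 x; rewrite le_eqVlt => /predU1P[<-|mux]; first by rewrite !mul0r.
by rewrite ler_pM2l// fg.
Qed.

Lemma expect_eq_supp mu f g : isDist mu ->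
  (forall x, 0 < mu x -> f x <= g x) ->
  expect mu g <= expect mu f -> forall x, 0 < mu x -> f x = g x.
Proof.
move=> [mu0 _] fg gf x mux.
have nn y : 0 <= mu y * (g y - f y).
  have := mu0 y; rewrite le_eqVlt => /predU1P[<-|muy]; first by rewrite mul0r.
  by rewrite pmulr_rge0// subr_ge0 fg.
have H : \sum_x mu x * (g x - f x) = 0.
  apply/eqP; rewrite eq_le; apply/andP; split.
    by rewrite -/(expect _ _) expectB subr_le0.
  by apply: sumr_ge0 => y _; exact: nn.
have /eqP : mu x * (g x - f x) = 0.
  by apply: (psumr_eq0P _ H) => // y _; exact: nn.
by rewrite mulf_eq0 gt_eqF//= subr_eq0 => /eqP.
Qed.

Lemma expect_mix (A : finType) (rho : A -> R) (fam : A -> S -> R) mu f :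
  (forall x, mu x = \sum_a rho a * fam a x) ->
  expect mu f = \sum_a rho a * expect (fam a) f.
Proof.
move=> mix; rewrite /expect.
under eq_bigr => x _ do rewrite mix mulr_suml.
rewrite exchange_big; apply: eq_bigr => a _.
by rewrite mulr_sumr; apply: eq_bigr => x _; rewrite mulrA.
Qed.

(* Both sides are the sum over [c] of [f c / #|class of c|] times the mass of
   the class of [c], which avoids choosing class representatives. *)
Lemma expect_class (Rel : rel S) mu nu f :
  reflexive Rel -> symmetric Rel -> transitive Rel ->
  (forall c, \sum_(u | Rel c u) mu u = \sum_(u | Rel c u) nu u) ->
  (forall x y, Rel x y -> f x = f y) -> expect mu f = expect nu f.
Proof.
move=> rR sR tR mn finv.
suff H m : expect m f = \sum_c f c / #|Rel c|%:R * \sum_(u | Rel c u) m u.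
  by rewrite !H; apply: eq_bigr => c _; rewrite mn.
under eq_bigr => c _ do rewrite mulr_sumr.
rewrite (exchange_big_dep predT)//=; apply: eq_bigr => u _.
rewrite (eq_bigl (Rel u)); last by move=> c; rewrite sR.
rewrite (eq_bigr (fun=> f u / #|Rel u|%:R * m u)) => [|c uc]; last first.
  rewrite (finv u c)//; congr (_ / _%:R * _); apply: eq_card => y.
  have cu : Rel c u by rewrite sR.
  by rewrite !unfold_in; apply/idP/idP => ?; apply: tR; eassumption.
rewrite sumr_const -mulrnAl -mulrnAr -[in RHS](mulr_natr _ #|_|) mulVf ?mulr1 1?mulrC //.
by rewrite pnatr_eq0 -lt0n; apply/card_gt0P; exists u; rewrite unfold_in.
Qed.

Lemma pos_class_mass (Rel : rel S) mu x : (forall x, 0 <= mu x) ->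
  Rel x x -> 0 < mu x -> 0 < \sum_(u | Rel x u) mu u.
Proof.
move=> mu0 rxx mux; rewrite (bigD1 x)//= ltr_pwDl// sumr_ge0//.
Qed.

Lemma pos_sum_witness (I : finType) (P : pred I) (F : I -> R) :
  0 < \sum_(i | P i) F i -> exists2 i, P i & 0 < F i.
Proof.
move=> H; apply/not_exists2P => F0; move: H; apply/negP; rewrite -leNgt.
by apply: sumr_le0 => i Pi; have [//|/negP] := F0 i; rewrite -leNgt.
Qed.

(** As the index set is finite, the largest of the pointwise indices serves all [i], and
    monotonicity carries each bound up to it. This exchanges limits over horizons with
    expectations. *)
Lemma unif_approx (I : finType) (f : nat -> I -> R) (v : I -> R) (e : R) :
  (forall n i, f n i <= f n.+1 i) ->
  (forall i, exists n, v i <= f n i + e) ->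
  exists n, forall i, v i <= f n i + e.
Proof.
move=> mono /choice[N HN]; exists (\max_i N i)%N => i.
apply: le_trans (HN i) _; rewrite lerD2r.
exact: (homo_leq (@lexx _ _) le_trans (fun n => mono n i)) (leq_bigmax i).
Qed.

End Expectation.

(** * Natures with memory and their extremal values over finite horizons *)

Section Automata.
Variables (R : realType) (S A AP : finType) (M : imdp R S A AP).

Definition is_fam (s : S) (f : A -> S -> R) : Prop :=
  forall a, Gamma M s a (f a).

Lemma fam_exists s : exists f, is_fam s f.
Proof. by have [f Hf] := choice (gamma_nonempty M s); exists f. Qed.

(* A nature with explicit memory: [nxt x s'] is the memory after a move to [s'].
   Natures proper are the special case where the memory is the finite path. *)
Record aut := Aut {
  ast : Type;
  cur : ast -> S;
  fam : ast -> A -> S -> R;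
  nxt : ast -> S -> ast;
  fam_ok : forall x, is_fam (cur x) (fam x);
  cur_nxt : forall x s, cur (nxt x s) = s
}.

Lemma fam_dist (B : aut) (x : ast B) a : isDist (fam x a).
Proof. by have [] := fam_ok x a. Qed.

(* [cls i s = Some b]: at time [i] in state [s] the objective is decided with
   outcome [b]; [None]: it is still open. *)
Definition objective := nat -> S -> option bool.
Definition negobj (cls : objective) : objective :=
  fun i s => omap negb (cls i s).

(* The largest probability of outcome [true] a scheduler can achieve against
   the automaton within [N] steps; [d] is the outcome if nothing is decided. *)
Fixpoint up (B : aut) (cls : objective) (d : bool) (N i : nat) (x : ast B) : R :=
  if N is n.+1 then
    if cls i (cur x) is Some b then b%:R
    else \big[Order.max/0]_a
      expect (fam x a) (fun s => up cls d n i.+1 (nxt x s))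
  else d%:R.

(** Dual of [up]: a scheduler minimises the probability of [true] by maximising that of the negated
    outcome, so facts on [low] follow from facts on [up]. *)
Definition low (B : aut) (cls : objective) (d : bool) (N i : nat) (x : ast B) : R :=
  1 - up (negobj cls) (~~ d) N i x.

Lemma natb01 (b : bool) : 0 <= (b%:R : R) <= 1.
Proof. by case: b; rewrite ?lexx ?ler01. Qed.

Lemma up01 (B : aut) cls d N i (x : ast B) : 0 <= up cls d N i x <= 1.
Proof.
elim: N i x => [|N IH] i x /=; first exact: natb01.
case: (cls _ _) => [b|]; first exact: natb01.
apply/andP; split; first exact: bigmax_ge_id.
apply: bigmax_le => // a _; apply: expect_le1; first exact: fam_dist.
by move=> s; have /andP[] := IH i.+1 (nxt x s).
Qed.

Lemma up_ge0 (B : aut) cls d N i (x : ast B) : 0 <= up cls d N i x.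
Proof. by have /andP[] := up01 cls d N i x. Qed.

Lemma up_le1 (B : aut) cls d N i (x : ast B) : up cls d N i x <= 1.
Proof. by have /andP[] := up01 cls d N i x. Qed.

Lemma upS_some (B : aut) cls d N i (x : ast B) b :
  cls i (cur x) = Some b -> up cls d N.+1 i x = b%:R.
Proof. by move=> /= ->. Qed.

Lemma upS_ge (B : aut) cls d N i (x : ast B) a : cls i (cur x) = None ->
  expect (fam x a) (fun s => up cls d N i.+1 (nxt x s)) <= up cls d N.+1 i x.
Proof. by move=> /= ->; exact: le_bigmax. Qed.

Lemma bigmax_attained (I : finType) (i0 : I) (F : I -> R) :
  (forall i, 0 <= F i) -> exists i, \big[Order.max/0]_i F i = F i.
Proof.
move=> F0; have [i _ Hi] := @arg_maxP _ _ _ i0 xpredT F isT.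
exists i; apply/eqP; rewrite eq_le le_bigmax andbT.
by apply: bigmax_le => // j _; exact: Hi.
Qed.

Lemma upS_attained (a0 : A) (B : aut) cls d N i (x : ast B) :
  cls i (cur x) = None ->
  exists a, up cls d N.+1 i x =
    expect (fam x a) (fun s => up cls d N i.+1 (nxt x s)).
Proof.
move=> /= ->; apply: (bigmax_attained a0) => a.
by apply: expect_ge0 => [|s]; [exact: fam_dist|exact: up_ge0].
Qed.

Lemma up_mono (B : aut) cls N i (x : ast B) :
  up cls false N i x <= up cls false N.+1 i x.
Proof.
elim: N i x => [|N IH] i x; first exact: up_ge0.
rewrite [leLHS]/= [leRHS]/=; case: (cls _ _) => [//|].
apply: bigmax_le => [|a _]; first exact: bigmax_ge_id.
apply: le_trans (le_bigmax _ _ a).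
by apply: expect_le => [|s]; [exact: fam_dist|exact: IH].
Qed.

Lemma up_static (B : aut) (u : S -> option bool) d N i (x : ast B) :
  up (fun=> u) d N i x = up (fun=> u) d N 0 x.
Proof.
elim: N i 0%N x => [//|N IH] i j x /=; case: (u _) => [//|].
by apply: eq_bigr => a _; apply: expect_eq => s; exact: IH.
Qed.

(** Forcing the outcome [d] from time [n] on encodes a fixed horizon with default [d] in the
    objective itself, so that results on all horizons with default [false] apply to it. *)
Definition trunc (n : nat) (d : bool) (cls : objective) : objective :=
  fun i s => if (i < n)%N then cls i s else Some d.

(** The horizon is one longer because the forced outcome is read at time [i + N]. *)
Lemma up_trunc (B : aut) cls d N i (x : ast B) :
  up (trunc (i + N) d cls) false N.+1 i x = up cls d N i x.
Proof.
elim: N i x => [|N IH] i x; first by rewrite /= /trunc addn0 ltnn.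
rewrite [RHS]/= -{}[in RHS](eq_bigr _ (fun a _ => expect_eq _ (fun s => IH i.+1 _))).
rewrite {1}/up -/(up _ _ _) {1}/trunc -addSnnS leq_addr.
by case: (cls _ _).
Qed.

Lemma up_trunc_le (B : aut) cls d N i k (x : ast B) :
  up (trunc (i + N) d cls) false k i x <= up cls d N i x.
Proof.
elim: N i k x => [|N IH] i [|k] x; rewrite ?up_ge0 //=.
  by rewrite /trunc addn0 ltnn.
rewrite {1}/trunc -addSnnS leq_addr; case: (cls _ _) => [//|].
apply: bigmax_le => [|a _]; first exact: bigmax_ge_id.
apply: le_trans (le_bigmax _ _ a).
by apply: expect_le => [|s]; [exact: fam_dist|exact: IH].
Qed.

Lemma low01 (B : aut) cls d N i (x : ast B) : 0 <= low cls d N i x <= 1.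
Proof. by rewrite /low; have := up01 (negobj cls) (~~ d) N i x; lra. Qed.

Lemma lowS_some (B : aut) cls d N i (x : ast B) b :
  cls i (cur x) = Some b -> low cls d N.+1 i x = b%:R.
Proof.
by move=> E; rewrite /low (@upS_some _ _ _ _ _ _ (~~ b)) /negobj ?E //; case: b {E} => /=; lra.
Qed.

Lemma lowS_le (B : aut) cls d N i (x : ast B) a : cls i (cur x) = None ->
  low cls d N.+1 i x <= expect (fam x a) (fun s => low cls d N i.+1 (nxt x s)).
Proof.
move=> E; rewrite /low expectB expect_cst; last exact: fam_dist.
by rewrite lerD2l lerN2; apply: upS_ge; rewrite /negobj E.
Qed.

Lemma lowS_attained (a0 : A) (B : aut) cls d N i (x : ast B) :
  cls i (cur x) = None ->
  exists a, low cls d N.+1 i x =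
    expect (fam x a) (fun s => low cls d N i.+1 (nxt x s)).
Proof.
move=> E; have [|a Ha] := @upS_attained a0 B (negobj cls) (~~ d) N i x.
  by rewrite /negobj E.
exists a; rewrite {1}/low Ha /low expectB expect_cst //; exact: fam_dist.
Qed.

Lemma lowS_ge (B : aut) cls d N i (x : ast B) c : cls i (cur x) = None ->
  c <= 1 ->
  (forall a, c <= expect (fam x a) (fun s => low cls d N i.+1 (nxt x s))) ->
  c <= low cls d N.+1 i x.
Proof.
move=> E c1 H; rewrite /low lerBrDl addrC -lerBrDl /= /negobj E /=.
apply: bigmax_le => [|a _]; first by rewrite subr_ge0.
have := H a; rewrite /low expectB expect_cst; last exact: fam_dist.
by rewrite /negobj; lra.
Qed.

Lemma low_mono (B : aut) cls N i (x : ast B) :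
  low cls false N i x <= low cls false N.+1 i x.
Proof.
elim: N i x => [|N IH] i x.
  by rewrite [leLHS]subrr; have /andP[] := low01 cls false 1 i x.
case E : (cls i (cur x)) => [b|]; first by rewrite !(lowS_some _ _ E).
apply: (lowS_ge E); first by have /andP[] := low01 cls false N.+1 i x.
move=> a; apply: le_trans (lowS_le false N a E) _.
by apply: expect_le => [|s]; [exact: fam_dist|exact: IH].
Qed.

Lemma low_static (B : aut) (u : S -> option bool) d N i (x : ast B) :
  low (fun=> u) d N i x = low (fun=> u) d N 0 x.
Proof. by rewrite /low; congr (1 - _); exact: (up_static (fun s => omap negb (u s))). Qed.

Section FromNature.
Variables (pi : Defs.fpath S -> A -> S -> R) (Npi : is_nature M pi).

Lemma flast_fext (w : Defs.fpath S) s : flast (fext w s) = s.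
Proof. by rewrite /flast /fext /= last_rcons. Qed.

Definition nat_aut : aut := @Aut (Defs.fpath S) (@flast S) pi (@fext S) Npi flast_fext.
End FromNature.

Section ToNature.
Variables (B : aut) (x0 : ast B).

(** The memory is recomputed from the path. The test fails only on one-state paths that start
    elsewhere than at [cur x0]; any family of that state will do there. *)
Definition aut_nat (w : Defs.fpath S) : A -> S -> R :=
  let x := foldl (@nxt B) x0 w.2 in
  if flast w == cur x then fam x else projT1 (cid (fam_exists (flast w))).

Lemma aut_natP : is_nature M aut_nat.
Proof.
move=> w a; rewrite /aut_nat; case: eqP => [->|_]; first exact: fam_ok.
exact: projT2 (cid (fam_exists (flast w))) a.
Qed.

Lemma cur_foldl l : cur (foldl (@nxt B) x0 l) = last (cur x0) l.
Proof. by elim/last_ind: l => [//|l y _]; rewrite foldl_rcons cur_nxt last_rcons. Qed.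

Lemma up_aut_nat cls d N i l :
  up cls d N i ((cur x0, l) : ast (nat_aut aut_natP)) =
  up cls d N i (foldl (@nxt B) x0 l).
Proof.
elim: N i l => [//|N IH] i l /=; rewrite /flast /= -cur_foldl.
case: (cls _ _) => [//|]; apply: eq_bigr => a _.
rewrite /aut_nat /flast /= -cur_foldl eqxx; apply: expect_eq => s.
by rewrite /fext /= IH foldl_rcons.
Qed.

Lemma low_aut_nat cls d N i l :
  low cls d N i ((cur x0, l) : ast (nat_aut aut_natP)) =
  low cls d N i (foldl (@nxt B) x0 l).
Proof. by rewrite /low up_aut_nat. Qed.
End ToNature.

Section Coinduction.
Variables (cls : objective) (K : nat -> S -> R -> Prop).
Hypothesis K_ge0 : forall i t c, K i t c -> 0 <= c.
Hypothesis K_step : forall i t c, K i t c ->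
  (forall b, cls i t = Some b -> b%:R <= c) /\
  exists f c', [/\ is_fam t f, forall y, K i.+1 y (c' y) &
    cls i t = None -> forall a, expect (f a) c' <= c].

(** [K i t c] is an invariant promising to keep [up] below [c] from time [i] in [t]. The triples
    satisfying it are the memory of the automaton, which plays the family and hands on the bounds
    given by [K_step]. *)
Lemma up_coind i t c : K i t c -> exists (B : aut) (x : ast B),
  cur x = t /\ forall N, up cls false N i x <= c.
Proof.
pose X := {z : nat * S * R | K z.1.1 z.1.2 z.2}.
have /choice[g Hg] : forall z : X, exists fc : (A -> S -> R) * (S -> R),
    [/\ is_fam (sval z).1.2 fc.1, forall y, K (sval z).1.1.+1 y (fc.2 y) &
    cls (sval z).1.1 (sval z).1.2 = None ->
      forall a, expect (fc.1 a) fc.2 <= (sval z).2].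
  by move=> [z Kz]; have [_ [f [c' H]]] := K_step Kz; exists (f, c').
have gf z : is_fam (sval z).1.2 (g z).1 by have [] := Hg z.
have gn z : forall y, K (sval z).1.1.+1 y ((g z).2 y) by have [] := Hg z.
pose nx (z : X) y : X :=
  exist (fun z => K z.1.1 z.1.2 z.2) ((sval z).1.1.+1, y, (g z).2 y) (gn z y).
pose B := @Aut X (fun z => (sval z).1.2) (fun z => (g z).1) nx gf (fun _ _ => erefl).
have H N (z : ast B) : up cls false N (sval z).1.1 z <= (sval z).2.
  elim: N z => [|N IH] z; first exact: (K_ge0 (proj2_sig z)).
  have [H1 _] := K_step (proj2_sig z); have [_ _ H2] := Hg z.
  rewrite /=; case E : (cls _ _) => [b|]; first exact: H1.
  apply: bigmax_le => [|a _]; first exact: (K_ge0 (proj2_sig z)).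
  apply: le_trans (H2 E a); apply: expect_le; first by have [] := gf z a.
  by move=> s; have := IH (nx z s).
move=> Kt; pose z : ast B := exist (fun z => K z.1.1 z.1.2 z.2) (i, t, c) Kt.
by exists B, z; split=> // N; exact: (H N z).
Qed.
End Coinduction.

(** * Simulation of automata along a bisimulation *)

Definition bisim_at (Rel : rel S) (s t : S) : Prop :=
  forall mus : A -> S -> R, is_fam s mus ->
    exists nus : A -> S -> R, is_fam t nus /\
      forall nu, mixes nus nu -> exists mu, mixes mus mu /\
        forall c : S, \sum_(u | Rel c u) mu u = \sum_(u | Rel c u) nu u.

Lemma mixes_self (nus : A -> S -> R) a : mixes nus (nus a).
Proof.
exists (fun b => (b == a)%:R); split.
  split=> [b|]; first exact: ler0n.
  by rewrite (bigD1 a)//= eqxx big1 ?addr0 // => b /negbTE ->.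
move=> x; rewrite (bigD1 a)//= eqxx mul1r big1 ?addr0 // => b /negbTE ->.
by rewrite mul0r.
Qed.

Lemma avg_le (rho : A -> R) (F : A -> R) c : isDist rho ->
  (forall a, F a <= c) -> \sum_a rho a * F a <= c.
Proof. by move=> Dr Fc; rewrite -[leRHS](expect_cst c Dr); exact: expect_le. Qed.

Section Simulation.
Variables (Rel : rel S) (cls : objective).
Hypotheses (rR : reflexive Rel) (sR : symmetric Rel) (tR : transitive Rel).
Hypothesis bis : forall s t, Rel s t -> bisim_at Rel s t.
Hypothesis cls_inv : forall i s t, Rel s t -> cls i s = cls i t.

Definition upsup (B : aut) (u : objective) (i : nat) (x : ast B) : R :=
  sup [set up u false N i x | N in setT].

Lemma upsup_ub (B : aut) u i (x : ast B) N : up u false N i x <= upsup u i x.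
Proof.
apply: ub_le_sup; last by exists N.
by exists 1 => _ [n _ <-]; exact: up_le1.
Qed.

Lemma upsup_approx (B : aut) u i (x : ast B) e : 0 < e ->
  exists N, upsup u i x <= up u false N i x + e.
Proof.
move=> e0; have [|_ [N _ <-] H] := @sup_adherent _ [set up u false N i x | N in setT] _ e0.
  split; first by exists (up u false 0 i x), 0%N.
  by exists 1 => _ [n _ <-]; exact: up_le1.
by exists N; rewrite -lerBlDr ltW.
Qed.

(** At one large horizon all successors are within [e] of their suprema, and there the bound [c] at
    the next horizon applies. *)
Lemma expect_upsup_le (B : aut) u i (x : ast B) a c : u i (cur x) = None ->
  (forall N, up u false N i x <= c) ->
  expect (fam x a) (fun y => upsup u i.+1 (nxt x y)) <= c.
Proof.
move=> E H; apply/ler_addgt0Pr => e e0.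
have [|N HN] := @unif_approx R S (fun N y => up u false N i.+1 (nxt x y))
  (fun y => upsup u i.+1 (nxt x y)) e (fun n y => up_mono _ _ _ _).
  by move=> y; exact: upsup_approx.
apply: le_trans (expect_leD (fam_dist x a) HN) _; rewrite lerD2r.
exact: le_trans (upS_ge _ _ _ E) (H N.+1).
Qed.

Lemma sim_up (B : aut) i (x : ast B) t c :
  Rel (cur x) t -> (forall N, up cls false N i x <= c) ->
  exists (B' : aut) (x' : ast B'),
    cur x' = t /\ forall N, up cls false N i x' <= c.
Proof.
(* The invariant: some automaton guarantees [c] from a state related to [t]. *)
pose K i t c := exists (B : aut) (x : ast B),
  Rel (cur x) t /\ forall N, up cls false N i x <= c.
move=> Rxt Hc; apply: (@up_coind cls K); last by exists B, x.
  by move=> {i t c Rxt Hc B x} i t c [B [x [_ /(_ 0%N)]]].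
move=> {i t c Rxt Hc B x} i t c [B [x [Rxt Hc]]]; split.
  move=> b; rewrite -(cls_inv i Rxt) => E.
  by have := Hc 1%N; rewrite (upS_some _ _ E).
have [nus [Fnus Hnus]] := bis Rxt (fam_ok x).
pose v y := upsup cls i.+1 (nxt x y).
(* [m y] is the state related to [y] that is best for nature. As [v (m y)] is constant on classes,
   its expectation under [nus a] equals that under the matching mixture. *)
have /choice[m Hm] y : exists z, Rel y z /\ forall z', Rel y z' -> v z <= v z'.
  by have [z Rz Hz] := @arg_minP _ _ _ y (Rel y) v (rR y); exists z.
exists nus, (fun y => v (m y)); split=> //.
  move=> y; exists B, (nxt x (m y)); split; last by move=> N; exact: upsup_ub.
  by rewrite cur_nxt sR; have [] := Hm y.
rewrite -(cls_inv i Rxt) => E a.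
have [mu [[rho [Drho mixmu]] Hmu]] := Hnus _ (mixes_self nus a).
rewrite -(@expect_class _ _ Rel mu)//; last first.
  move=> y z Ryz; have [Ry Hy] := Hm y; have [Rz Hz] := Hm z.
  apply: le_anti; rewrite Hy ?Hz //; last exact: tR Rz.
  by apply: tR Ry; rewrite sR.
(* It remains to bound each action of the mixture; replacing [v (m y)] by [v y] only increases its
   expectation. *)
rewrite (expect_mix _ mixmu); apply: avg_le => // b.
apply: le_trans (expect_upsup_le b E Hc); apply: expect_le; first exact: fam_dist.
by move=> y; have [_ ->//] := Hm y.
Qed.

End Simulation.

Section FiniteSimulation.
Variables (Rel : rel S) (cls : objective).
Hypotheses (rR : reflexive Rel) (sR : symmetric Rel) (tR : transitive Rel).
Hypothesis bis : forall s t, Rel s t -> bisim_at Rel s t.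
Hypothesis cls_inv : forall i s t, Rel s t -> cls i s = cls i t.

Lemma sim_up_fin (B : aut) d N (x : ast B) t : Rel (cur x) t ->
  exists (B' : aut) (x' : ast B'),
    cur x' = t /\ up cls d N 0 x' <= up cls d N 0 x.
Proof.
move=> Rxt; have [||B' [x' [cx' H]]] := @sim_up Rel (trunc N d cls) rR sR tR bis _ B 0%N x t
  (up cls d N 0 x) Rxt.
- by move=> i s1 s2 Rs; rewrite /trunc (cls_inv _ Rs).
- by move=> k; exact: (@up_trunc_le B cls d N 0).
by exists B', x'; split=> //; rewrite -(up_trunc cls d N 0 x') H.
Qed.

End FiniteSimulation.

Lemma sim_low_fin (Rel : rel S) (cls : objective) :
  reflexive Rel -> symmetric Rel -> transitive Rel ->
  (forall s t, Rel s t -> bisim_at Rel s t) ->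
  (forall i s t, Rel s t -> cls i s = cls i t) ->
  forall (B : aut) d N (x : ast B) t, Rel (cur x) t ->
  exists (B' : aut) (x' : ast B'),
    cur x' = t /\ low cls d N 0 x <= low cls d N 0 x'.
Proof.
move=> rR sR tR bis inv B d N x t Rxt.
have [|B' [x' [cx' H]]] := sim_up_fin (cls := negobj cls) rR sR tR bis _ (~~ d) N Rxt.
  by move=> i s1 s2 Rs; rewrite /negobj (inv _ _ _ Rs).
by exists B', x'; split=> //; rewrite /low lerD2l lerN2.
Qed.

End Automata.

(** * Schedulers against a fixed nature *)

Section Schedulers.
Variables (R : realType) (S A AP : finType) (M : imdp R S A AP).

Definition step (sg : Defs.fpath S -> A -> R) (pi : Defs.fpath S -> A -> S -> R)
  (w : Defs.fpath S) (s : S) : R := \sum_a sg w a * pi w a s.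

(** Backward recursion for the probability of outcome [true]; [prob_acc] identifies it with the path
    measure. *)
Fixpoint pval (sg : Defs.fpath S -> A -> R) (pi : Defs.fpath S -> A -> S -> R)
    (cls : objective S) (d : bool) (N i : nat) (w : Defs.fpath S) : R :=
  if N is n.+1 then
    if cls i (flast w) is Some b then b%:R
    else expect (step sg pi w) (fun s => pval sg pi cls d n i.+1 (fext w s))
  else d%:R.

Lemma expect_step sg pi w f :
  expect (step sg pi w) f = \sum_a sg w a * expect (pi w a) f.
Proof. exact: expect_mix. Qed.

Lemma step_dist sg pi w : is_scheduler sg -> is_nature M pi ->
  isDist (step sg pi w).
Proof.
move=> Hsg Hpi; split=> [s|].
  apply: sumr_ge0 => a _; have [s0 _] := Hsg w; have [[p0 _] _] := Hpi w a.
  exact: mulr_ge0.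
rewrite /step exchange_big /=; have [_ <-] := Hsg w; apply: eq_bigr => a _.
by rewrite -mulr_sumr; have [[_ ->] _] := Hpi w a; rewrite mulr1.
Qed.

Lemma pval_neg sg pi cls d N i w : is_scheduler sg -> is_nature M pi ->
  pval sg pi (negobj cls) (~~ d) N i w = 1 - pval sg pi cls d N i w.
Proof.
move=> Hsg Hpi; elim: N i w => [|N IH] i w /=; first by case: d => /=; lra.
rewrite {1}/negobj; case: (cls _ _) => [b|] /=; first by case: b => /=; lra.
rewrite (expect_eq _ (fun s => IH i.+1 (fext w s))) expectB expect_cst //.
exact: step_dist.
Qed.

Section FixedNature.
Variables (pi : Defs.fpath S -> A -> S -> R) (Npi : is_nature M pi).
Notation B := (nat_aut Npi).

Lemma pval_le_up sg cls d N i (w : ast B) : is_scheduler sg ->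
  pval sg pi cls d N i w <= up cls d N i w.
Proof.
move=> Hsg; elim: N i w => [//|N IH] i w /=; case: (cls _ _) => [//|].
rewrite expect_step; apply: avg_le; first exact: Hsg.
move=> a; apply: le_trans (le_bigmax _ _ a).
by apply: expect_le => [|s]; [exact: (@fam_dist _ _ _ _ _ B)|exact: IH].
Qed.

Lemma low_le_pval sg cls d N i (w : ast B) : is_scheduler sg ->
  low cls d N i w <= pval sg pi cls d N i w.
Proof.
move=> Hsg; rewrite /low.
have := pval_le_up (negobj cls) (~~ d) N i w Hsg; rewrite pval_neg //; lra.
Qed.

Definition dsched (phi : Defs.fpath S -> A) (w : Defs.fpath S) (a : A) : R :=
  (a == phi w)%:R.

Lemma dsched_scheduler phi : is_scheduler (dsched phi).
Proof.
move=> w; split=> [a|]; first exact: ler0n.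
by rewrite /dsched (bigD1 (phi w))//= eqxx big1 ?addr0 // => b /negbTE ->.
Qed.

Lemma expect_dsched (pi' : Defs.fpath S -> A -> S -> R) phi w f :
  expect (step (dsched phi) pi' w) f = expect (pi' w (phi w)) f.
Proof.
rewrite expect_step /dsched (bigD1 (phi w))//= eqxx mul1r big1 ?addr0 // => b /negbTE ->.
by rewrite mul0r.
Qed.

Lemma up_attained (a0 : A) cls d N s : exists2 sg, is_scheduler sg &
  pval sg pi cls d N 0 (s, [::]) = up cls d N 0 ((s, [::]) : ast B).
Proof.
(* The remaining horizon is [N - size w.2], so one action per path can be optimal at every stage. *)
have /choice[phi Hphi] (w : ast B) : exists a, forall n,
    (n.+1 + size w.2)%N = N -> cls (size w.2) (flast w) = None ->
    up cls d n.+1 (size w.2) w =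
      expect (pi w a) (fun s => up cls d n (size w.2).+1 (fext w s : ast B)).
  case E : (cls (size w.2) (flast w)) => [b|]; first by exists a0.
  have [a Ha] := @upS_attained _ _ _ _ _ a0 B cls d (N - size w.2).-1 (size w.2) w E.
  by exists a => n HN _; move: Ha; rewrite -HN addnK.
exists (dsched phi); first exact: dsched_scheduler.
suff H n (w : ast B) : (n + size w.2)%N = N ->
    pval (dsched phi) pi cls d n (size w.2) w = up cls d n (size w.2) w.
  by apply: (H N (s, [::])); rewrite addn0.
elim: n w => [//|n IH] w Hn; case E : (cls (size w.2) (flast w)) => [b|].
  by rewrite /= E.
rewrite [LHS]/= E expect_dsched Hphi //; apply: expect_eq => y.
by have /= := IH (fext w y); rewrite size_rcons; apply; rewrite addnS -addSn.
Qed.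

Lemma low_attained (a0 : A) cls d N s : exists2 sg, is_scheduler sg &
  pval sg pi cls d N 0 (s, [::]) = low cls d N 0 ((s, [::]) : ast B).
Proof.
have [sg Hsg H] := up_attained a0 (negobj cls) (~~ d) N s.
by exists sg => //; rewrite /low -H pval_neg // opprB addrC subrK.
Qed.

End FixedNature.

(** * Least probabilities for an unbounded horizon *)

Section Lowsup.
Variables (u : S -> option bool) (B : aut M).
Implicit Type x : ast B.

Definition lowsup x : R := sup [set low (fun=> u) false N 0 x | N in setT].

Lemma lowsup_has_sup x : has_sup [set low (fun=> u) false N 0 x | N in setT].
Proof.
split; first by exists (low (fun=> u) false 0 0 x), 0%N.
by exists 1 => _ [n _ <-]; have /andP[] := low01 (fun=> u) false n 0 x.
Qed.

Lemma lowsup_ub x N : low (fun=> u) false N 0 x <= lowsup x.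
Proof. by apply: sup_upper_bound (lowsup_has_sup x) _ _; exists N. Qed.

Lemma lowsup_le x c :
  (forall N, low (fun=> u) false N 0 x <= c) -> lowsup x <= c.
Proof. by move=> H; apply: ge_sup => [|_ [n _ <-]//]; case: (lowsup_has_sup x). Qed.

Lemma lowsup_approx x e : 0 < e ->
  exists N, lowsup x < low (fun=> u) false N 0 x + e.
Proof.
move=> e0; have [_ [N _ <-] H] := sup_adherent e0 (lowsup_has_sup x).
by exists N; rewrite -ltrBlDr.
Qed.

Lemma lowsup_ge0 x : 0 <= lowsup x.
Proof. by apply: le_trans (lowsup_ub x 0); have /andP[] := low01 (fun=> u) false 0 0 x. Qed.

Lemma lowsup_le1 x : lowsup x <= 1.
Proof. by apply: lowsup_le => N; have /andP[] := low01 (fun=> u) false N 0 x. Qed.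

Lemma lowsup_some x b : u (cur x) = Some b -> lowsup x = b%:R.
Proof.
move=> E; apply: le_anti; apply/andP; split.
  apply: lowsup_le => N; apply: le_trans (low_mono _ _ _ _) _.
  by rewrite (lowS_some _ _ (E : (fun=> u) 0%N (cur x) = _)).
by rewrite -(lowS_some false 0 (E : (fun=> u) 0%N (cur x) = _)); exact: lowsup_ub.
Qed.

Lemma lowsup_le_expect x a : u (cur x) = None ->
  lowsup x <= expect (fam x a) (fun s => lowsup (nxt x s)).
Proof.
move=> E; apply: lowsup_le => N; apply: le_trans (low_mono _ _ _ _) _.
apply: le_trans (lowS_le false N a (E : (fun=> u) 0%N (cur x) = _)) _.
apply: expect_le => [|s]; first exact: fam_dist.
by rewrite low_static; exact: lowsup_ub.
Qed.

(** At a large horizon all successors are within [e] of their limits, so the action [b] optimal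
    there exceeds [lowsup x] by at most [e]. The action [a] minimising the expected limits does no
    worse than [b], whatever [e] is. *)
Lemma lowsup_attained (a0 : A) x : u (cur x) = None ->
  exists a, expect (fam x a) (fun s => lowsup (nxt x s)) <= lowsup x.
Proof.
move=> E; pose F a := expect (fam x a) (fun s => lowsup (nxt x s)).
have [a _ Ha] := @arg_minP _ _ _ a0 xpredT F isT; exists a; rewrite -/(F a).
apply/ler_addgt0Pr => e e0.
have [||N HN] := @unif_approx R S (fun N y => low (fun=> u) false N 0 (nxt x y))
  (fun y => lowsup (nxt x y)) e.
- by move=> n i; exact: low_mono.
- by move=> y; have [N HN] := lowsup_approx (nxt x y) e0; exists N; exact: ltW.
have [b Hb] := lowS_attained a0 false N (E : (fun=> u) 0%N (cur x) = _).
apply: le_trans (Ha b isT) _; apply: le_trans (expect_leD (fam_dist x b) HN) _.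
rewrite lerD2r; apply: le_trans (lowsup_ub x N.+1); rewrite Hb.
by apply: expect_le => [|s]; [exact: fam_dist|rewrite low_static].
Qed.

End Lowsup.

(** Playing the actions of [lowsup_attained] everywhere keeps the probability below [lowsup] at all
    horizons at once, so one scheduler attains the infimum. *)
Lemma lowsup_sched (a0 : A) pi (Npi : is_nature M pi) (u : S -> option bool) :
  exists2 sg, is_scheduler sg & forall N i w,
    pval sg pi (fun=> u) false N i w <= lowsup u (w : ast (nat_aut Npi)).
Proof.
have /choice[phi Hphi] (w : ast (nat_aut Npi)) : exists a, u (flast w) = None ->
    expect (pi w a) (fun s => lowsup u (fext w s : ast (nat_aut Npi))) <= lowsup u w.
  case E : (u (flast w)) => [b|]; first by exists a0.
  by have [a Ha] := @lowsup_attained u (nat_aut Npi) a0 w E; exists a.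
exists (dsched phi); first exact: dsched_scheduler.
elim=> [|N IH] i w; first exact: lowsup_ge0.
rewrite /=; case E : (u (flast w)) => [b|].
  by rewrite (@lowsup_some u (nat_aut Npi) w b E).
rewrite expect_dsched; apply: le_trans (Hphi w E).
by apply: expect_le => [|s]; [have [] := Npi w (phi w)|exact: IH].
Qed.

End Schedulers.

(** * Value iteration for a maximising scheduler against a minimising nature *)

Section ValueIteration.
Variables (R : realType) (S A AP : finType) (M : imdp R S A AP).
Variable u : S -> option bool.

(** An infimum, since intervals need not be closed and a least expectation need not exist. *)
Definition minexp (f : S -> R) (s : S) (a : A) : R :=
  inf [set expect mu f | mu in Gamma M s a].

Lemma minexp_has_inf f s a : (forall x, 0 <= f x) ->
  has_inf [set expect mu f | mu in Gamma M s a].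
Proof.
move=> f0; split; last by exists 0 => _ [mu [Dmu _] <-]; exact: expect_ge0.
by have [mu Hmu] := gamma_nonempty M s a; exists (expect mu f), mu.
Qed.

Lemma minexp_le f s a mu : (forall x, 0 <= f x) -> Gamma M s a mu ->
  minexp f s a <= expect mu f.
Proof.
by move=> f0 Hmu; apply: ge_inf; [case: (minexp_has_inf s a f0)|exists mu].
Qed.

Lemma minexp_ge f s a c : (forall mu, Gamma M s a mu -> c <= expect mu f) ->
  c <= minexp f s a.
Proof.
move=> H; apply: lb_le_inf => [|_ [mu Hmu <-]]; last exact: H.
by have [mu Hmu] := gamma_nonempty M s a; exists (expect mu f), mu.
Qed.

Lemma minexp_approx f s a e : (forall x, 0 <= f x) -> 0 < e ->
  exists2 mu, Gamma M s a mu & expect mu f <= minexp f s a + e.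
Proof.
move=> f0 e0; have [_ [mu Hmu <-] /ltW H] := inf_adherent e0 (minexp_has_inf s a f0).
by exists mu.
Qed.

(* [k] rounds of [lam]-discounted value iteration for the game in which the
   scheduler maximises and nature minimises the probability of [true]. *)
Fixpoint vi (lam : R) (k : nat) (s : S) : R :=
  if k is n.+1 then
    if u s is Some b then b%:R
    else lam * \big[Order.max/0]_a minexp (vi lam n) s a
  else 0.

Lemma vi01 (lam : R) k s : 0 <= lam <= 1 -> 0 <= vi lam k s <= 1.
Proof.
move=> /andP[l0 l1]; elim: k s => [|k IH] s /=; first by rewrite lexx ler01.
case: (u s) => [b|]; first exact: natb01.
rewrite mulr_ge0//=; last exact: bigmax_ge_id.
apply: mulr_ile1 => //; first exact: bigmax_ge_id.
apply: bigmax_le => // a _; have [mu Hmu] := gamma_nonempty M s a.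
apply: le_trans (minexp_le _ Hmu) _ => [x|]; first by have /andP[] := IH x.
apply: expect_le1 => [|x]; [by case: Hmu|by have /andP[] := IH x].
Qed.

Lemma minexp_homo f g s a : (forall x, 0 <= f x) -> (forall x, f x <= g x) ->
  minexp f s a <= minexp g s a.
Proof.
move=> f0 fg; apply: minexp_ge => mu Hmu; apply: le_trans (minexp_le f0 Hmu) _.
by apply: expect_le => //; case: Hmu.
Qed.

Lemma vi_mono (lam : R) k s : 0 <= lam <= 1 -> vi lam k s <= vi lam k.+1 s.
Proof.
move=> Hl; elim: k s => [|k IH] s; first by have /andP[] := vi01 1 s Hl.
rewrite [leLHS]/= [leRHS]/=; case: (u s) => [//|].
case/andP: (Hl) => l0 _; rewrite ler_wpM2l//.
apply: bigmax_le => [|a _]; first exact: bigmax_ge_id.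
apply: le_trans (le_bigmax _ _ a); apply: minexp_homo => // x.
by have /andP[] := vi01 k x Hl.
Qed.

(** Along [k] rounds the discount is applied at most [k] times. *)
Lemma vi_discount (a0 : A) (lam : R) k s : 0 <= lam <= 1 ->
  lam ^+ k * vi 1 k s <= vi lam k s.
Proof.
move=> Hl; case/andP: (Hl) => l0 l1; have H1 : 0 <= (1 : R) <= 1 by rewrite ler01 lexx.
have v0 n x : 0 <= vi 1 n x by have /andP[] := vi01 n x H1.
have vl0 n x : 0 <= vi lam n x by have /andP[] := vi01 n x Hl.
elim: k s => [|k IH] s /=; first by rewrite mulr0.
case: (u s) => [b|]; first by rewrite ler_piMl// exprn_ile1.
rewrite exprS mul1r -mulrA ler_wpM2l//.
have m0 a : 0 <= minexp (vi 1 k) s a.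
  by apply: minexp_ge => mu [Dmu _]; exact: expect_ge0.
have [a ->] := bigmax_attained a0 m0.
apply: le_trans (le_bigmax _ _ a); apply: minexp_ge => mu Hmu.
apply: le_trans (_ : expect mu (fun x => lam ^+ k * vi 1 k x) <= _).
  by rewrite expectZ ler_wpM2l ?exprn_ge0// minexp_le.
by apply: expect_le => //; case: Hmu.
Qed.

(* The greedy positional scheduler for [vi lam k] loses at most [lam ^+ N] in
   [N] steps, because [vi lam k <= vi lam k.+1] is a sub-solution of the
   discounted optimality equation. *)
Lemma vi_sched (a0 : A) (lam : R) k : 0 <= lam <= 1 ->
  exists phi : {ffun S -> A}, forall pi, is_nature M pi -> forall N i w,
    vi lam k (flast w) - lam ^+ N <=
      pval (dsched R (fun w => phi (flast w))) pi (fun=> u) false N i w.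
Proof.
move=> Hl; case/andP: (Hl) => l0 l1.
have vl0 n x : 0 <= vi lam n x by have /andP[] := vi01 n x Hl.
have m0 s a : 0 <= minexp (vi lam k) s a.
  by apply: minexp_ge => mu [Dmu _]; exact: expect_ge0.
have /choice[phi Hphi] s := bigmax_attained a0 (m0 s).
exists [ffun s => phi s] => pi Hpi; elim=> [|N IH] i w /=.
  by rewrite expr0 subr_le0; have /andP[] := vi01 k (flast w) Hl.
set s := flast w; case E : (u s) => [b|].
  apply: le_trans (_ : vi lam k.+1 s <= _); last by rewrite /= E.
  by rewrite lerBlDr; apply: le_trans (vi_mono k s Hl) _; rewrite lerDl exprn_ge0.
rewrite expect_dsched ffunE.
have Dpi : isDist (pi w (phi s)) by case: (Hpi w (phi s)).
rewrite lerBlDr; apply: le_trans (vi_mono k s Hl) _; rewrite /= E Hphi.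
apply: le_trans (ler_wpM2l l0 (minexp_le (vl0 k) (Hpi w (phi s)))) _.
have : expect (pi w (phi s)) (vi lam k) <= expect (pi w (phi s)) (fun x =>
    pval (dsched R (fun w => [ffun s => phi s] (flast w))) pi (fun=> u) false N i.+1
      (fext w x)) + lam ^+ N.
  apply: expect_leD => // x.
  by have := IH i.+1 (fext w x); rewrite flast_fext lerBlDr.
move=> /(ler_wpM2l l0) /le_trans; apply; rewrite mulrDr exprS lerD2r.
rewrite ler_piMl//; apply: expect_ge0 => // x.
elim: N {IH} i.+1 (fext w x) => [//|N IH] j v /=.
case: (u _) => [b|]; first exact: ler0n.
by rewrite expect_dsched; apply: expect_ge0 => //; case: (Hpi v ([ffun s => phi s] (flast v))).
Qed.

Lemma vi_nature s c0 c : (forall k, vi 1 k s <= c0) -> c0 < c ->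
  exists (B : aut M) (x : ast B),
    cur x = s /\ forall N, up (fun=> u) false N 0 x <= c.
Proof.
have H1 : 0 <= (1 : R) <= 1 by rewrite ler01 lexx.
have v0 n x : 0 <= vi 1 n x by have /andP[] := vi01 n x H1.
pose V x := sup [set vi 1 k x | k in setT].
have hs x : has_sup [set vi 1 k x | k in setT].
  split; first by exists (vi 1 0 x), 0%N.
  by exists 1 => _ [k _ <-]; have /andP[] := vi01 k x H1.
have Vub k x : vi 1 k x <= V x by apply: sup_upper_bound (hs x) _ _; exists k.
move=> Hc0 c0c; pose K (i : nat) t c := V t < c.
apply: (@up_coind _ _ _ _ M (fun=> u) K).
- by move=> i t e Ve; exact: ltW (le_lt_trans (le_trans (v0 0%N t) (Vub 0%N t)) Ve).
- move=> i t e; rewrite /K => Ve; split=> [b E|].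
    by apply: ltW; apply: le_lt_trans Ve; have := Vub 1%N t; rewrite /= E.
  (* Three of the four quarters get spent: on approximating [V] by [vi 1 k], on the near-minimal
     distributions, and on the margin of the successors. *)
  pose del := (e - V t) / 4; have del0 : 0 < del by rewrite /del; lra.
  have [||k Hk] := @unif_approx R S (fun k x => vi 1 k x) V del.
  + by move=> n x; exact: vi_mono.
  + move=> x; have [_ [k _ <-] /ltW Hk] := sup_adherent del0 (hs x).
    by exists k; rewrite -lerBlDr.
  have /choice[f Hf] a : exists mu, Gamma M t a mu /\
      expect mu (vi 1 k) <= minexp (vi 1 k) t a + del.
    by have [mu] := minexp_approx t a (v0 k) del0; exists mu.
  exists f, (fun x => V x + del); split=> [a|x|E a]; first by case: (Hf a).
    by rewrite /K ltrDl.
  have [Ga Ea] := Hf a; have Da : isDist (f a) by case: Ga.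
  rewrite expectD expect_cst//; have := expect_leD Da Hk.
  have : minexp (vi 1 k) t a <= V t.
    apply: le_trans (Vub k.+1 t); rewrite /= E mul1r; exact: le_bigmax.
  by rewrite /del in Ea *; lra.
by apply: le_lt_trans c0c; apply: ge_sup => [|_ [k _ <-]//]; case: (hs s).
Qed.

End ValueIteration.

(** * Max-min values, optimal natures and the attractor *)

Section Attractor.
Variables (R : realType) (S A AP : finType) (M : imdp R S A AP).
Variables (u : S -> option bool) (Rel : rel S) (a0 : A).
Hypotheses (rR : reflexive Rel) (sR : symmetric Rel) (tR : transitive Rel).
Hypothesis bis : forall s t, Rel s t -> bisim_at M Rel s t.
Hypothesis u_inv : forall s t, Rel s t -> u s = u t.

Let guarantees s : set R :=
  [set r | exists (B : aut M) (x : ast B), cur x = s /\ r = lowsup u x].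

Definition optval s : R := sup (guarantees s).

Definition const_aut : aut M :=
  @Aut R S A AP M S id (fun s => projT1 (cid (fam_exists M s))) (fun _ s => s)
    (fun s => projT2 (cid (fam_exists M s))) (fun _ _ => erefl).

Lemma guarantees_has_sup s : has_sup (guarantees s).
Proof.
split; first by exists (lowsup u (s : ast const_aut)), const_aut, s.
by exists 1 => _ [B [x [_ ->]]]; exact: lowsup_le1.
Qed.

Lemma optval_ub (B : aut M) (x : ast B) : lowsup u x <= optval (cur x).
Proof. by apply: sup_upper_bound (guarantees_has_sup _) _ _; exists B, x. Qed.

Lemma optval_approx s e : 0 < e ->
  exists (B : aut M) (x : ast B), cur x = s /\ optval s < lowsup u x + e.
Proof.
move=> e0; have [_ [B [x [cx ->]]] H] := sup_adherent e0 (guarantees_has_sup s).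
by exists B, x; split=> //; rewrite -ltrBlDr.
Qed.

Lemma optval_le1 s : optval s <= 1.
Proof.
apply: ge_sup => [|_ [B [x [_ ->]]]]; last exact: lowsup_le1.
by case: (guarantees_has_sup s).
Qed.

Lemma optval_some_false s : u s = Some false -> optval s <= 0.
Proof.
move=> E; apply: ge_sup => [|_ [B [x [cx ->]]]]; first by case: (guarantees_has_sup s).
by rewrite (lowsup_some (b := false)) // cx.
Qed.

(** A nearly optimal automaton nearly reaches its limit within a finite horizon, which can be
    simulated. Half of [e] goes to each approximation. *)
Lemma optval_inv s t : Rel s t -> optval s = optval t.
Proof.
suff H x y : Rel x y -> optval x <= optval y.
  by move=> Rst; apply: le_anti; rewrite !H// sR.
move=> Rxy; apply/ler_addgt0Pr => e e0; have e2 : 0 < e / 2 by rewrite divr_gt0.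
have [B [z [cz Hz]]] := optval_approx x e2.
have [N HN] := lowsup_approx u z e2.
have [||B' [z' [cz' Hz']]] := @sim_low_fin R S A AP M Rel (fun=> u) rR sR tR bis _ B
  false N z y; [by move=> _; exact: u_inv|by rewrite cz|].
have := optval_ub z'; have := lowsup_ub u z' N; rewrite cz'; lra.
Qed.

Definition optimal s :=
  exists (B : aut M) (x : ast B), cur x = s /\ optval s <= lowsup u x.

(** The closure of the optimal states under [Rel]: it makes the attractor invariant before
    optimality itself is known to be. *)
Definition optimal_class t := exists s, optimal s /\ Rel s t.

(* An action attaining [optval t] is critical: nature gains nothing from it, so
   it has to stay in optimal classes and approach the goal. *)
Fixpoint attr (n : nat) (t : S) : Prop :=
  if n is m.+1 then
    attr m t \/
    (u t = None /\ exists f, is_fam M t f /\ forall a,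
      optval t <= expect (f a) optval /\
      (expect (f a) optval <= optval t ->
        (forall x, 0 < f a x -> optimal_class x) /\
        exists x, 0 < f a x /\ attr m x))
  else u t = Some true \/ optval t <= 0.

Lemma optimal_class_inv s t : optimal_class s -> Rel s t -> optimal_class t.
Proof. by move=> [r [Or Rrs]] Rst; exists r; split=> //; exact: tR Rst. Qed.

Lemma attr_mono n m t : (n <= m)%N -> attr n t -> attr m t.
Proof.
elim: m => [|m IH]; first by rewrite leqn0 => /eqP->.
by rewrite leq_eqVlt => /predU1P[->//|/IH H] An; left; exact: H.
Qed.

(** An action of the answering family amounts, up to classes, to a mixture of the given ones. If it
    is critical, so is every action of positive weight, since none falls below [optval s]; support
    and progress then carry over class by class. *)
Lemma attr_inv n s t : Rel s t -> attr n s -> attr n t.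
Proof.
elim: n s t => [|n IH] s t Rst.
  by move=> /= [H|H]; [left; rewrite -(u_inv Rst)|right; rewrite -(optval_inv Rst)].
move=> [/(IH _ _ Rst)|[E [f [Ff Hf]]]]; first by left.
right; split; first by rewrite -(u_inv Rst).
have [g [Fg Hg]] := bis Rst Ff; exists g; split=> // a.
have [mu [[rho [Drho mixmu]] Hmu]] := Hg _ (mixes_self g a).
have [Dga _] := Fg a; have g0 : forall x, 0 <= g a x by case: Dga.
have Ef : expect (g a) optval = \sum_b rho b * expect (f b) optval.
  rewrite -(expect_mix _ mixmu); apply/esym.
  by apply: (expect_class rR sR tR) => // x y; exact: optval_inv.
have rho0 : forall b, 0 <= rho b by case: Drho.
have f0 b x : 0 <= f b x by case: (Ff b) => -[].
have mu_wit x : 0 < g a x -> exists b z, [/\ 0 < rho b, 0 < f b z & Rel x z].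
  move=> gx; have := pos_class_mass g0 (rR x) gx; rewrite -Hmu.
  move=> /pos_sum_witness[z Rxz]; rewrite mixmu => /pos_sum_witness[b _ H].
  exists b, z; split=> //; rewrite lt_neqAle eq_sym ?rho0 ?f0 andbT;
    by apply: contraTneq H => ->; rewrite ?mul0r ?mulr0 ltxx.
rewrite -(optval_inv Rst) Ef; split.
  rewrite -[leLHS](expect_cst (optval s) Drho); apply: expect_le => // b.
  by have [] := Hf b.
move=> eqV; have eqb b : 0 < rho b -> expect (f b) optval <= optval s.
  move=> rb; rewrite -(@expect_eq_supp _ _ rho (fun=> optval s) (fun b => expect (f b) optval) Drho _ _ b rb) //.
    by move=> b' _; have [] := Hf b'.
  by rewrite expect_cst.
split=> [x gx|].
  have [b [z [rb fz Rxz]]] := mu_wit x gx.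
  have [_ /(_ (eqb b rb))[/(_ z fz) Oz _]] := Hf b.
  by apply: optimal_class_inv Oz _; rewrite sR.
have [b _ rb] : exists2 b, true & 0 < rho b.
  by apply: pos_sum_witness; case: Drho => _ ->.
have [_ /(_ (eqb b rb))[_ [z [fz Az]]]] := Hf b.
have : 0 < \sum_(v | Rel z v) mu v.
  rewrite (bigD1 z)//=; apply: ltr_pwDl.
    rewrite mixmu (bigD1 b)//=; apply: ltr_pwDl; first exact: mulr_gt0.
    by apply: sumr_ge0 => b' _; exact: mulr_ge0.
  apply: sumr_ge0 => x _; rewrite mixmu; apply: sumr_ge0 => b' _; exact: mulr_ge0.
rewrite Hmu => /pos_sum_witness[x Rzx gx]; exists x; split=> //.
exact: IH Rzx Az.
Qed.

Lemma attr_stable : exists N, forall n t, attr n t -> attr N t.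
Proof.
have /choice[r Hr] t : exists m, forall n, attr n t -> attr m t.
  have [[m Hm]|H] := pselect (exists m, attr m t); first by exists m.
  by exists 0%N => n An; case: H; exists n.
exists (\max_t r t)%N => n t /Hr; apply: attr_mono; exact: leq_bigmax.
Qed.

(* Outside the attractor some action keeps the play outside of it, at no loss
   of optimality, so a supposedly optimal automaton never reaches the goal. *)
Lemma optimal_attr s : optimal s -> exists n, attr n s.
Proof.
have [N HN] := attr_stable.
have key k (B : aut M) (x : ast B) : optval (cur x) <= lowsup u x ->
    ~ attr N (cur x) -> low (fun=> u) false k 0 x <= 0.
  elim: k x => [|k IH] x Ox nA; first by rewrite /low /= subrr.
  case E : (u (cur x)) => [[]|].
  - by case: nA; apply: (HN 0%N); left.
  - by case: nA; apply: (HN 0%N); right; exact: optval_some_false.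
  have Hle a : optval (cur x) <= expect (fam x a) optval.
    apply: le_trans Ox _; apply: le_trans (lowsup_le_expect a E) _.
    apply: expect_le => [|s']; first exact: fam_dist.
    by rewrite -[in leRHS](cur_nxt x s'); exact: optval_ub.
  have Hopt a : expect (fam x a) optval <= optval (cur x) -> forall y,
      0 < fam x a y -> optval y <= lowsup u (nxt x y).
    move=> Ha y fy; rewrite -(@expect_eq_supp _ _ (fam x a)
      (fun y => lowsup u (nxt x y)) optval (fam_dist x a) _ _ y fy) //.
      by move=> z _; rewrite -[in leRHS](cur_nxt x z); exact: optval_ub.
    apply: le_trans Ha _; apply: le_trans Ox _; exact: lowsup_le_expect.
  (* Otherwise the family played at [x] would put [cur x] into level [N.+1], hence into level
     [N]. *)
  have [a [Ha1 Ha2]] : exists a, expect (fam x a) optval <= optval (cur x) /\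
      forall y, 0 < fam x a y -> ~ attr N y.
    apply: contrapT => no; apply: nA; apply: (HN N.+1); right; split=> //.
    exists (fam x); split; first exact: fam_ok.
    move=> a; split=> // Ha; split=> [y fy|].
      by exists y; split=> //; exists B, (nxt x y); rewrite cur_nxt; split=> //; exact: Hopt fy.
    apply: contrapT => no2; apply: no; exists a; split=> // y fy Ay.
    by apply: no2; exists y.
  apply: le_trans (lowS_le false k a (E : (fun=> u) 0%N (cur x) = _)) _.
  rewrite -[leRHS](expect_cst 0 (fam_dist x a)).
  apply: expect_le_supp => [|y fy]; first exact: fam_dist.
  rewrite low_static; apply: IH; rewrite cur_nxt; first exact: Hopt fy.
  exact: Ha2.
move=> [B [x [<- Ox]]]; exists N; apply: contrapT => nA.
apply: (nA); apply: (HN 0%N); right; apply: (le_trans (Ox)).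
by apply: lowsup_le => k; exact: (key k B x Ox nA).
Qed.

(** The minimum starts from [1], which covers the case without positive values. *)
Lemma positive_gap (I : finType) (F : I -> R) :
  exists2 e : R, 0 < e & forall i, 0 < F i -> e <= F i.
Proof.
exists (\big[Order.min/1]_(i | 0 < F i) F i); last by move=> i; exact: bigmin_le_cond.
by apply: lt_bigmin => // i.
Qed.

(* Nature plays rank-decreasing optimal families inside the attractor and, once
   the play leaves it, an [e]-optimal automaton.  Leaving requires an action
   that gains at least [e], so nothing is lost. *)
Lemma optimal_inv s t : optimal s -> Rel s t -> optimal t.
Proof.
move=> Os Rst; have [N HN] := attr_stable; pose inT y := attr N y.
have nearT y : optimal_class y -> inT y.
  by move=> [x [/optimal_attr[n An] Rxy]]; apply: (HN n); exact: attr_inv Rxy An.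
have /choice[rk Hrk] y : exists r, inT y -> attr r y /\ forall n, attr n y -> (r <= n)%N.
  have [Ty|nTy] := pselect (inT y); last by exists 0%N.
  have ex : exists n, `[< attr n y >] by exists N; apply/asboolP.
  case: (ex_minnP ex) => r /asboolP Ar Hr; exists r => _; split=> // n An.
  by apply: Hr; apply/asboolP.
have /choice[g Hg] y : exists f, is_fam M y f /\ (inT y -> ~ attr 0 y ->
    u y = None /\ forall a, optval y <= expect (f a) optval /\
      (expect (f a) optval <= optval y ->
        (forall x, 0 < f a x -> inT x) /\
        exists x, [/\ 0 < f a x, inT x & (rk x < rk y)%N])).
  have [[Ty n0]|no] := pselect (inT y /\ ~ attr 0 y); last first.
    by have [f Ff] := fam_exists M y; exists f; split=> // Ty n0; case: no.
  have [] := Hrk y Ty; case: (rk y) => [//|r] /= Ar Hmin; case: Ar.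
  - by move=> /Hmin; rewrite ltnn.
  - move=> [E [f [Ff Hf]]]; exists f; split=> // _ _; split=> // a; have [H1 H2] := Hf a; split=> // /H2[H3 [x [fx Ax]]].
  split=> [z fz|]; first exact/nearT/H3.
  have Tx : inT x by apply: (HN r).
  by exists x; split=> //; rewrite ltnS; have [_] := Hrk x Tx; apply.
(* [e] bounds from below every positive gain of an action under [g]. *)
have [e e0 He] := positive_gap (fun p : S * A => expect (g p.1 p.2) optval - optval p.1).
have /choice[eo Heo] y : exists eo : {B : aut M & ast B},
    cur (projT2 eo) = y /\ optval y < lowsup u (projT2 eo) + e.
  by have [B [x H]] := optval_approx y e0; exists (existT _ B x).
(* [inl y] while the play stays in the attractor and follows [g]; [inr] once it has left, with the
   state of exit and the memory of the [e]-optimal automaton started there. *)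
pose X := (S + {y : S & ast (projT1 (eo y))})%type.
pose curX (x : X) := match x with inl y => y | inr z => cur (projT2 z) end.
pose famX (x : X) := match x with inl y => g y | inr z => fam (projT2 z) end.
pose out y : X := inr (existT (fun y => ast (projT1 (eo y))) y (projT2 (eo y))).
pose nxtX (x : X) (y : S) : X := match x with
  | inl _ => if pselect (inT y) then inl y else out y
  | inr z => inr (existT (fun y => ast (projT1 (eo y))) (projT1 z) (nxt (projT2 z) y))
  end.
have famX_ok x : is_fam M (curX x) (famX x).
  by case: x => [y|z] /=; [case: (Hg y)|exact: fam_ok].
have cur_nxtX x y : curX (nxtX x y) = y.
  case: x => [z|z] /=; last exact: cur_nxt.
  by case: pselect => Ty //=; case: (Heo y).
pose B := @Aut R S A AP M X curX famX nxtX famX_ok cur_nxtX.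
have up_inr cls d n i z : up cls d n i (inr z : ast B) = up cls d n i (projT2 z).
  elim: n i z => [//|n IH] i z /=; case: (cls _ _) => [//|].
  by apply: eq_bigr => a _; apply: expect_eq => y; rewrite IH.
have h_out y : optval y < lowsup u (out y : ast B) + e.
  suff -> : lowsup u (out y : ast B) = lowsup u (projT2 (eo y)) by case: (Heo y).
  rewrite /lowsup; congr (sup _); apply: eq_imagel => n _.
  by rewrite /low up_inr.
pose h y := lowsup u (inl y : ast B).
(* The deficit of [B] at [y]. If it is positive somewhere in the attractor, let [y1] maximise it
   there and let [y2] have least rank among the maximisers. *)
pose del y := optval y - h y.
suff H y : inT y -> del y <= 0.
  exists B, (inl t); split=> //; rewrite -subr_le0; apply: (H t); apply: nearT.
  by exists s.
move=> Ty; rewrite leNgt; apply/negP => dy.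
pose T : pred S := fun y => `[< inT y >].
have [y1 /asboolP Ty1 Hy1] := @arg_maxP _ _ _ y T del (asboolT Ty).
pose D : pred S := fun y => T y && (del y == del y1).
have Dy1 : D y1 by rewrite /D eqxx andbT; exact/asboolP.
have [y2 /andP[/asboolP Ty2 /eqP dy2] Hy2] := @arg_minP _ _ _ y1 D rk Dy1.
have d0 : 0 < del y1 by apply: lt_le_trans dy _; apply: Hy1; exact/asboolP.
have n0 : ~ attr 0 y2.
  move=> /= [E|V0]; move: d0; rewrite -dy2 /del /h.
    by rewrite (lowsup_some (b := true)) // ltNge subr_le0 optval_le1.
  rewrite ltNge subr_le0 (le_trans V0) //; exact: lowsup_ge0.
have [_ Hgy2] := Hg y2; have {Hgy2} [E Hgy2] := Hgy2 Ty2 n0.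
have [a Ha] := @lowsup_attained _ _ _ _ M u B a0 (inl y2) E.
have Dga : isDist (g y2 a) by case: (Hg y2) => /(_ a)[].
pose del' y := optval y - lowsup u (nxtX (inl y2) y : ast B).
have del'T z : inT z -> del' z = del z.
  by rewrite /del' /del /h /=; case: pselect.
have del'_le z : inT z -> del' z <= del y1.
  by move=> Tz; rewrite del'T //; apply: Hy1; exact/asboolP.
have Edel' : expect (g y2 a) optval - h y2 <= expect (g y2 a) del'.
  by rewrite expectB lerD2l lerN2.
have [H1 H2] := Hgy2 a.
(* Without gain the play stays in the attractor and the mean deficit is still maximal. So every
   possible successor has maximal deficit, including one of smaller rank than [y2]. *)
have [eqV|ltV] := leP (expect (g y2 a) optval) (optval y2).
  have [supT [x [gx Tx rkx]]] := H2 eqV.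
  suff dx : del x = del y1.
    have Dx : D x by rewrite /D dx eqxx andbT; exact/asboolP.
    by have := Hy2 x Dx; rewrite leEnat leqNgt rkx.
  rewrite -del'T //; apply: (@expect_eq_supp _ _ (g y2 a) del' (fun=> del y1)) => //.
    by move=> z gz; apply: del'_le; exact: supT.
  by rewrite expect_cst // -dy2; apply: le_trans Edel'; rewrite /del lerD2r.
(* The gain is at least [e], while the deficit after the move is at most [del y1] inside the
   attractor and at most [e] outside. Both are less than [del y1 + e]. *)
have := He (y2, a); rewrite subr_gt0 => /(_ ltV) /= gap.
have : expect (g y2 a) del' <= Num.max (del y1) e.
  rewrite -[leRHS](expect_cst _ Dga); apply: expect_le => // z.
  rewrite le_max; have [Tz|nTz] := pselect (inT z); first by rewrite del'_le.
  apply/orP; right; rewrite /del' /=; case: pselect => Tz //=.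
  by rewrite lerBlDl ltW.
have : Num.max (del y1) e < del y1 + e by rewrite gt_max; lra.
by move: Edel' dy2; rewrite /del; lra.
Qed.

End Attractor.

(** * Probability measures on infinite paths *)

Section PathMeasure.
Variables (R : realType) (S : finType).
Implicit Types (X Y : set (ipath S)).
Notation meas := (@cyl_measurable S).

Lemma meas0 : meas set0.
Proof. exact: sigma_algebra0. Qed.

Lemma measC X : meas X -> meas (~` X).
Proof. by move=> mX; rewrite -setTD; exact: sigma_algebraCD. Qed.

Lemma meas_bigcup (F : nat -> set (ipath S)) :
  (forall n, meas (F n)) -> meas (\bigcup_n F n).
Proof. exact: sigma_algebra_bigcup. Qed.

Lemma measU X Y : meas X -> meas Y -> meas (X `|` Y).
Proof.
by move=> mX mY; rewrite -bigcup2E; apply: meas_bigcup => -[|[|n]] //=; exact: meas0.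
Qed.

Lemma measI X Y : meas X -> meas Y -> meas (X `&` Y).
Proof.
move=> mX mY; rewrite -[X in meas X]setCK setCI.
by apply: measC; apply: measU; exact: measC.
Qed.

Lemma measD X Y : meas X -> meas Y -> meas (X `\` Y).
Proof. by move=> mX mY; rewrite setDE; apply: measI => //; exact: measC. Qed.

Lemma meas_cyl w : meas (Cyl w).
Proof. by apply: sub_sigma_algebra; exists w. Qed.

Lemma meas_bigU (I : finType) (F : I -> set (ipath S)) (r : seq I) :
  (forall i, meas (F i)) -> meas (\big[setU/set0]_(i <- r) F i).
Proof. by move=> mF; elim/big_ind: _ => //; [exact: meas0|exact: measU]. Qed.

Variable P : set (ipath S) -> \bar R.
Hypothesis HP : is_prob_measure P.

Lemma prob0 : P set0 = 0%E. Proof. by case: HP. Qed.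

Lemma prob_ge0 X : meas X -> (0 <= P X)%E. Proof. by case: HP => _ H _ _; exact: H. Qed.

Lemma prob_sigma (F : nat -> set (ipath S)) : (forall n, meas (F n)) ->
  trivIset setT F ->
  (fun n => \sum_(0 <= i < n) P (F i))%E @ \oo --> P (\bigcup_n F n).
Proof. by case: HP => _ _ H _; exact: H. Qed.

Lemma probU X Y : meas X -> meas Y -> X `&` Y = set0 ->
  P (X `|` Y) = (P X + P Y)%E.
Proof.
move=> mX mY XY0; rewrite -bigcup2E.
have H : (fun n => \sum_(0 <= i < n) P (bigcup2 X Y i))%E @ \oo --> P (\bigcup_n bigcup2 X Y n).
  apply: prob_sigma; last by rewrite -trivIset_bigcup2.
  by move=> [|[|n]] //=; exact: meas0.
apply: (cvg_unique (@ereal_hausdorff R) H).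
apply: cvg_near_cst; near=> n.
have n2 : (2 <= n)%N by near: n; exact: nbhs_infty_ge.
rewrite -(subnK n2) addn2 !big_nat_recl//= big1 ?adde0 // => i _; exact: prob0.
Unshelve. all: by end_near. Qed.

Lemma prob_le X Y : meas X -> meas Y -> X `<=` Y -> (P X <= P Y)%E.
Proof.
move=> mX mY XY; rewrite -(setDUK XY) probU //; last first.
- by rewrite setDE setICA setICr setI0.
- exact: measD.
by rewrite leeDl// prob_ge0//; exact: measD.
Qed.

Lemma prob_fin X : meas X -> P X \is a fin_num.
Proof.
move=> mX; rewrite ge0_fin_numE ?prob_ge0 //.
apply: le_lt_trans (prob_le mX (_ : meas setT) (@subsetT _ _)) _.
  by rewrite -setC0; apply: measC; exact: meas0.
by case: HP => _ _ _ ->; rewrite ltry.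
Qed.

Lemma prob_bigU (I : finType) (F : I -> set (ipath S)) :
  (forall i, meas (F i)) -> (forall i j, i != j -> F i `&` F j = set0) ->
  P (\big[setU/set0]_i F i) = (\sum_i P (F i))%E.
Proof.
move=> mF dF; have : uniq (index_enum I) by exact: index_enum_uniq.
elim: (index_enum I) => [|i r IH]; first by rewrite !big_nil prob0.
move=> /= /andP[ir ur]; rewrite !big_cons probU ?IH //; first exact: meas_bigU.
rewrite big_distrr /= big_seq big1 // => j jr; apply: dF.
by apply: contraNneq ir => ->.
Qed.

(** Continuity from below: the increments [seqD F] are disjoint and their partial sums are the
    [P (F n)]. *)
Lemma prob_bigcup_le (F : nat -> set (ipath S)) c :
  (forall n, meas (F n)) -> (forall n, F n `<=` F n.+1) ->
  (forall n, (P (F n) <= c)%E) -> (P (\bigcup_n F n) <= c)%E.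
Proof.
move=> mF incF Fc; have ndF : nondecreasing_seq F.
  by apply/nondecreasing_seqP => n; apply/subsetPset; exact: incF.
rewrite -(eq_bigcup_seqD F).
have mD n : meas (seqD F n) by case: n => [|n] /=; [exact: mF|exact: measD].
have H := prob_sigma mD (trivIset_seqD ndF).
apply: (cvge_to_le H); apply: nearW => -[|n].
  by rewrite big_nil; apply: le_trans (Fc 0%N); exact: prob_ge0.
suff -> : (\sum_(0 <= i < n.+1) P (seqD F i) = P (F n))%E by [].
elim: n => [|n IH]; first by rewrite big_nat1.
rewrite big_nat_recr//= IH -[in RHS](setDUK (incF n)) probU //.
- exact: measD.
- by rewrite setDE setICA setICr setI0.
Unshelve. all: by end_near. Qed.

End PathMeasure.

(** * Probabilities of objectives under a scheduler and a nature *)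

Section ObjectiveProbability.
Variables (R : realType) (S A : finType).
Variables (sg : Defs.fpath S -> A -> R) (pi : Defs.fpath S -> A -> S -> R).

Fixpoint acc (cls : objective S) (d : bool) (N i : nat) (w : ipath S) : bool :=
  if N is n.+1 then odflt (acc cls d n i.+1 w) (cls i (w i)) else d.

Lemma Cyl_fext (u : Defs.fpath S) s :
  Cyl (fext u s) = Cyl u `&` [set w | w (size (fseq u)) = s].
Proof.
case: u => [x l]; rewrite /fext /Cyl /fseq /=; apply/seteqP; split => w /=.
  move=> H; split=> [i il|]; last first.
    by rewrite H ?size_rcons //= nth_rcons ltnn eqxx.
  by rewrite H ?size_rcons ?ltnS 1?ltnW // -rcons_cons nth_rcons il.
move=> [H1 H2] i; rewrite size_rcons ltnS leq_eqVlt => /predU1P[->|il].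
  by rewrite -rcons_cons nth_rcons ltnn eqxx.
by rewrite H1 // -rcons_cons nth_rcons il.
Qed.

Lemma Cyl_last (u : Defs.fpath S) w : Cyl u w -> w (size u.2) = flast u.
Proof. by case: u => x l H; rewrite (H (size l)) // /flast /= (last_nth x). Qed.

Lemma bigsetU_finP (T : Type) (I : finType) (F : I -> set T) t :
  (\big[setU/set0]_i F i) t <-> exists i, F i t.
Proof.
rewrite -bigcup_seq; split=> [[i _ Ft]|[i Ft]]; first by exists i.
by exists i => //=; exact: mem_index_enum.
Qed.

Lemma Cyl_cut (u : Defs.fpath S) (X : set (ipath S)) :
  Cyl u `&` X = \big[setU/set0]_s (Cyl (fext u s) `&` X).
Proof.
apply/seteqP; split=> w.
  move=> [Cu Xw]; apply/bigsetU_finP; exists (w (size (fseq u))).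
  by rewrite Cyl_fext.
by move=> /bigsetU_finP[s]; rewrite Cyl_fext => -[[Cu _] Xw].
Qed.

Lemma meas_acc cls d N i : cyl_measurable [set w : ipath S | acc cls d N i w].
Proof.
have mpos j (s : S) : cyl_measurable [set w : ipath S | w j = s].
  (* A countable union over codes of finite paths: each member is the cylinder of the coded path if
     that path reaches [s] after [j] moves, and empty otherwise. *)
  have -> : [set w : ipath S | w j = s] =
      \bigcup_n [set w | w j = s /\ (Some (w 0%N, mkseq (fun k => w k.+1) j) == unpickle n)].
    apply/seteqP; split=> w /=; last by case=> n _ [].
    by move=> ws; exists (pickle (w 0%N, mkseq (fun k => w k.+1) j)) => //=; rewrite pickleK.
  apply: meas_bigcup => n; case E : (unpickle n) => [u|]; last first.
    rewrite (_ : [set _ | _] = set0); first exact: meas0.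
    by apply/seteqP; split=> w [].
  have [H|H] := pselect (size u.2 = j /\ flast u = s); last first.
    rewrite (_ : [set _ | _] = set0); first exact: meas0.
    apply/seteqP; split=> w; last by [].
    move=> /= [ws /eqP[ueq]]; apply: H; rewrite -ueq /= size_mkseq.
    split=> //; rewrite /flast /=; case: j ws {ueq E} => [//|j] <-.
    by rewrite (last_nth (w 0%N)) size_mkseq /= nth_mkseq.
  rewrite (_ : [set _ | _] = Cyl u); first exact: meas_cyl.
  case: H => uj us; apply/seteqP; split=> w /=.
    move=> [_ /eqP[<-]] k; rewrite /= size_mkseq ltnS; case: k => [//|k] kj /=.
    by rewrite nth_mkseq.
  move=> Cu; split; first by rewrite -uj Cyl_last.
  apply/eqP; congr Some; case: u uj us Cu {E} => x l /= uj us Cu; congr (_, _).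
    by rewrite Cu.
  apply: (@eq_from_nth _ x); first by rewrite size_mkseq.
  by move=> k; rewrite size_mkseq => kj; rewrite nth_mkseq // Cu // /= ltnS uj.
elim: N i => [|N IH] i /=.
  case: d; last by rewrite (_ : [set _ | _] = set0); [exact: meas0|apply/seteqP; split].
  rewrite (_ : [set _ | _] = ~` set0); first by apply: measC; exact: meas0.
  by rewrite setC0; apply/seteqP; split.
have -> : [set w : ipath S | odflt (acc cls d N i.+1 w) (cls i (w i))] =
    \big[setU/set0]_s ([set w | w i = s] `&`
      [set w | odflt (acc cls d N i.+1 w) (cls i s)]).
  apply/seteqP; split=> w.
    by move=> H; apply/bigsetU_finP; exists (w i).
  by move=> /bigsetU_finP[s [/= <-]].
apply: meas_bigU => s; apply: measI; first exact: mpos.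
case: (cls i s) => [[]|] /=; last exact: IH.
  rewrite (_ : [set _ | _] = ~` set0); first by apply: measC; exact: meas0.
  by rewrite setC0; apply/seteqP; split.
by rewrite (_ : [set _ | _] = set0); [exact: meas0|apply/seteqP; split].
Qed.

(** The formula is proved inside every cylinder, weighted by its probability: cutting a cylinder by
    the next state matches one step of [pval]. The cylinder of [s] has full measure. *)
Lemma prob_acc s P cls d N : is_Pr sg pi s P ->
  P [set w | acc cls d N 0 w] = (pval sg pi cls d N 0 (s, [::]))%:E.
Proof.
move=> [HP H0 Hext].
have cylfin u : P (Cyl u) \is a fin_num by apply: prob_fin => //; exact: meas_cyl.
have macc := meas_acc cls d.
have key n u : P (Cyl u `&` [set w | acc cls d n (size u.2) w]) =
    (P (Cyl u) * (pval sg pi cls d n (size u.2) u)%:E)%E.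
  elim: n u => [|n IH] u.
    case: d macc => _ /=; rewrite ?mule1 ?mule0; first by congr P; apply/seteqP; split=> w // [].
    by rewrite (_ : _ `&` _ = set0) ?(prob0 HP) //; apply/seteqP; split=> w // [].
  case E : (cls (size u.2) (flast u)) => [b|].
    rewrite /= E; case: b E => E; rewrite ?mule1 ?mule0.
      congr P; apply/seteqP; split=> w; first by case.
      by move=> Cu; split=> //=; rewrite (Cyl_last Cu) E.
    rewrite (_ : _ `&` _ = set0) ?(prob0 HP) //; apply/seteqP; split=> w //.
    by move=> [Cu] /=; rewrite (Cyl_last Cu) E.
  rewrite [in RHS]/= E Cyl_cut prob_bigU //; first last.
  - move=> x y xy; apply/seteqP; split=> w //; rewrite !Cyl_fext.
    by move=> [[[_ /= wx] _] [[_ /= wy] _]]; move/eqP: xy; apply; rewrite -wx -wy.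
  - by move=> x; apply: measI; [exact: meas_cyl|exact: macc].
  rewrite -(fineK (cylfin u)) -EFinM /expect mulr_sumr -sumEFin.
  apply: eq_bigr => x _; have := IH (fext u x).
  rewrite Hext -(fineK (cylfin u)) -/(step sg pi u x) -!EFinM [size _]size_rcons.
  rewrite -mulrA => <-; congr P; apply/seteqP; split=> w [Cw] /= Hw; split=> //=;
    by move: Hw Cw; rewrite Cyl_fext => + [Cu _] /=; rewrite (Cyl_last Cu) E.
have := key N (s, [::]); rewrite H0 eqxx mul1e => <-.
have mc : cyl_measurable (Cyl (s, [::])) by exact: meas_cyl.
rewrite -[in LHS](setUIDK [set w | acc cls d N 0 w] (Cyl (s, [::]))) probU //.
- rewrite setIC [X in (_ + X)%E](_ : _ = 0%E) ?adde0 //.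
  apply: le_anti; apply/andP; split; last by apply: prob_ge0 => //; exact: measD.
  apply: le_trans (_ : P (~` Cyl (s, [::])) <= _)%E.
    by apply: (prob_le HP (measD (macc N 0%N) mc) (measC mc)) => w [].
  have PT : P setT = 1%E by case: HP.
  have := probU HP mc (measC mc) (setICr _); rewrite setUCr PT H0 eqxx.
  have := prob_fin HP (measC mc); case: (P _) => // r _ /eqP.
  rewrite -EFinD eqe lee_fin => /eqP; lra.
- exact: measI.
- exact: measD.
- by apply/seteqP; split=> w // [[_ Cw] [_ /(_ Cw)]].
Qed.

End ObjectiveProbability.

(** * Existence of the path measure *)

Section Cells.
Variables (R : realType) (S : finType) (mu : S -> R).
Hypothesis Dmu : isDist mu.

(** Left ends of the cells that cut [[0, 1[] in proportion to [mu], in the order of [enum_rank]. *)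
Definition cumul (k : nat) : R := \sum_(y | (enum_rank y < k)%N) mu y.

Lemma cumul_mono k m : (k <= m)%N -> cumul k <= cumul m.
Proof.
move=> km; case: Dmu => mu0 _; rewrite /cumul [leRHS](bigID (fun y => (enum_rank y < k)%N))/=.
rewrite [X in X + _](eq_bigl (fun y => (enum_rank y < k)%N)); last first.
  move=> y; case: (ltnP (enum_rank y) k) => [yk|]; last by rewrite andbF.
  by rewrite andbT (leq_trans yk km).
by rewrite lerDl sumr_ge0.
Qed.

Lemma cumul_rankS x : cumul (enum_rank x).+1 = cumul (enum_rank x) + mu x.
Proof.
rewrite /cumul (bigD1 x)//= addrC; congr (_ + _); apply: eq_bigl => y.
by rewrite ltnS [RHS]ltn_neqAle andbC -(inj_eq enum_rank_inj).
Qed.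

Lemma cumul0 : cumul 0 = 0. Proof. by rewrite /cumul big_pred0. Qed.

Lemma cumul_card : cumul #|S| = 1.
Proof. by case: Dmu => _ <-; apply: eq_bigl => y; rewrite ltn_ord. Qed.

Lemma cumul_ge0 k : 0 <= cumul k.
Proof. by rewrite -cumul0; exact: cumul_mono. Qed.

Lemma cumul_rank_le1 x : cumul (enum_rank x) + mu x <= 1.
Proof. by rewrite -cumul_rankS -cumul_card; exact: cumul_mono. Qed.

Lemma cell_exists z : 0 <= z < 1 ->
  exists x, cumul (enum_rank x) <= z < cumul (enum_rank x) + mu x.
Proof.
move=> /andP[z0 z1]; have ex : exists k, z < cumul k by exists #|S|; rewrite cumul_card.
case: (ex_minnP ex) => -[|k] Hk Hmin; first by move: Hk; rewrite cumul0 ltNge z0.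
have kS : (k < #|S|)%N by apply: Hmin; rewrite cumul_card.
exists (enum_val (Ordinal kS)); rewrite -cumul_rankS enum_valK /= Hk andbT.
by rewrite leNgt; apply/negP => /Hmin; rewrite ltnn.
Qed.

Lemma cell_unique z x y :
  cumul (enum_rank x) <= z < cumul (enum_rank x) + mu x ->
  cumul (enum_rank y) <= z < cumul (enum_rank y) + mu y -> x = y.
Proof.
rewrite -!cumul_rankS => /andP[x1 x2] /andP[y1 y2].
apply: enum_rank_inj; apply: val_inj => /=.
case: (ltngtP (enum_rank x) (enum_rank y)) => // /cumul_mono H.
  by have := lt_le_trans x2 (le_trans H y1); rewrite ltxx.
by have := lt_le_trans y2 (le_trans H x1); rewrite ltxx.
Qed.

End Cells.

(* The measure of a strategy pair is the law of the path obtained by following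
   a uniform point of [0, 1[ through nested intervals: the interval of a finite
   path is cut in proportion to the transition probabilities. *)
Section Existence.
Variables (R : realType) (S : finType) (kap : Defs.fpath S -> S -> R) (s0 : S).
Hypothesis Dkap : forall w, isDist (kap w).

(** The triple holds a finite path with the left end and the length of its interval. *)
Let cut (st : Defs.fpath S * R * R) (x : S) :=
  (fext st.1.1 x, st.1.2 + st.2 * cumul (kap st.1.1) (enum_rank x),
   st.2 * kap st.1.1 x).
Let st l := foldl cut ((s0, [::]), 0, 1) l.
Let lo l := (st l).1.2.
Let len l := (st l).2.

Let st_path l : (st l).1.1 = (s0, l).
Proof.
by elim/last_ind: l => [//|l x IH]; rewrite /st foldl_rcons /= -/(st l) IH.
Qed.

Let lo_rcons l x :
  lo (rcons l x) = lo l + len l * cumul (kap (s0, l)) (enum_rank x).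
Proof. by rewrite /lo /len /st foldl_rcons /= -/(st l) st_path. Qed.

Let len_rcons l x : len (rcons l x) = len l * kap (s0, l) x.
Proof. by rewrite /len /st foldl_rcons /= -/(st l) st_path. Qed.

Let len_ge0 l : 0 <= len l.
Proof.
elim/last_ind: l => [|l x IH]; first exact: ler01.
by rewrite len_rcons mulr_ge0//; case: (Dkap (s0, l)).
Qed.

Let inI z l := lo l <= z < lo l + len l.

Let inI_len z l : inI z l -> 0 < len l.
Proof. by move=> /andP[H1 H2]; have := le_lt_trans H1 H2; rewrite ltrDl. Qed.

Let inI_rcons z l x : 0 < len l -> inI z (rcons l x) =
  (cumul (kap (s0, l)) (enum_rank x) <= (z - lo l) / len l <
    cumul (kap (s0, l)) (enum_rank x) + kap (s0, l) x).
Proof.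
move=> l0; rewrite /inI lo_rcons len_rcons ler_pdivlMr// ltr_pdivrMr//.
by rewrite lerBrDl ltrBlDl mulrDl addrA ![_ * len l]mulrC.
Qed.

Let inI_exists z l : inI z l -> exists x, inI z (rcons l x).
Proof.
move=> zl; have l0 := inI_len zl.
have [|x Hx] := @cell_exists R S _ (Dkap (s0, l)) ((z - lo l) / len l).
  rewrite ler_pdivlMr// ltr_pdivrMr// mul0r mul1r subr_ge0 ltrBlDl; exact: zl.
by exists x; rewrite inI_rcons.
Qed.

Let inI_belast z l x : inI z (rcons l x) -> inI z l.
Proof.
move=> zlx; have := inI_len zlx; rewrite len_rcons => H.
have l0 : 0 < len l.
  by rewrite lt_neqAle len_ge0 andbT eq_sym; apply: contraTneq H => ->; rewrite mul0r ltxx.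
move: zlx; rewrite inI_rcons// => /andP[H1 H2].
have := le_trans (cumul_ge0 (Dkap _) _) H1.
have := lt_le_trans H2 (cumul_rank_le1 (Dkap _) _).
by rewrite ler_pdivlMr// ltr_pdivrMr// mul0r mul1r subr_ge0 ltrBlDl /inI => -> ->.
Qed.

Let inI_unique z l x y : inI z (rcons l x) -> inI z (rcons l y) -> x = y.
Proof.
move=> zx; have l0 := inI_len (inI_belast zx); move: zx.
rewrite !inI_rcons//; exact: cell_unique.
Qed.

Let nx z l : S :=
  if pselect (exists x, inI z (rcons l x)) is left ex then projT1 (cid ex) else s0.

Let nxP z l : inI z l -> inI z (rcons l (nx z l)).
Proof.
move=> /inI_exists ex; rewrite /nx; case: pselect => // ex'.
exact: projT2 (cid ex').
Qed.

Let traj z n : seq S := iter n (fun l => rcons l (nx z l)) [::].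
Let path z : ipath S := fun n => last s0 (traj z n).

Let size_traj z n : size (traj z n) = n.
Proof. by elim: n => [//|n IH]; rewrite /traj iterS size_rcons -/(traj z n) IH. Qed.

Let nth_traj z n i : (i <= n)%N -> nth s0 (s0 :: traj z n) i = path z i.
Proof.
elim: n => [|n IH]; first by rewrite leqn0 => /eqP->.
rewrite leq_eqVlt => /predU1P[->|].
  by rewrite /path (last_nth s0) size_traj.
rewrite ltnS => im; rewrite -IH// /traj iterS -/(traj z n) -rcons_cons nth_rcons.
by rewrite /= size_traj ltnS im.
Qed.

Let inI_traj z n : 0 <= z < 1 -> inI z (traj z n).
Proof.
move=> z01; elim: n => [|n IH]; last exact: nxP.
by rewrite /inI /lo /len /= add0r.
Qed.

Let traj_inI z l : inI z l -> traj z (size l) = l.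
Proof.
elim/last_ind: l => [//|l x IH] zlx; have zl := inI_belast zlx.
rewrite size_rcons /traj iterS -/(traj z (size l)) IH//.
by congr rcons; apply: inI_unique zlx; exact: nxP.
Qed.

Let cyl_path z l : 0 <= z < 1 -> Cyl (s0, l) (path z) <-> inI z l.
Proof.
move=> z01; split=> [H|/traj_inI E i].
  suff <- : traj z (size l) = l by exact: inI_traj.
  apply: (@eq_from_nth _ s0); rewrite size_traj // => i il.
  by have := H i.+1 il; rewrite -(@nth_traj z (size l) i.+1).
by rewrite /= ltnS => il; rewrite -(nth_traj _ il) E.
Qed.

Let unit_itv : set R := [set` `[0, 1[%R].
Let law (X : set (ipath S)) : \bar R :=
  lebesgue_measure (unit_itv `&` path @^-1` X).

Let unit_itvP z : unit_itv z <-> 0 <= z < 1.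
Proof. by rewrite /unit_itv /= in_itv. Qed.

Let law_cyl l : law (Cyl (s0, l)) = (len l)%:E.
Proof.
rewrite /law (_ : _ `&` _ = [set` `[lo l, lo l + len l[%R]); last first.
  apply/seteqP; split=> z /=; rewrite !in_itv /= => H.
    by case: H => z01 H; apply/(cyl_path l z01).
  have z01 : 0 <= z < 1.
    elim/last_ind: l H => [|l x IH] H; last exact: IH (inI_belast H).
    by move: H; rewrite /lo /len /= add0r.
  by split=> //; apply/cyl_path.
rewrite lebesgue_measure_itv /= lte_fin ltrDl.
have [_|] := ltP 0 (len l); first by rewrite -EFinB addrAC subrr add0r.
by move=> H; congr EFin; apply: le_anti; rewrite len_ge0.
Qed.

Let law_cyl0 s l : s != s0 -> law (Cyl (s, l)) = 0%E.
Proof.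
move=> ss0; rewrite /law (_ : _ `&` _ = set0) ?measure0//.
apply/seteqP; split=> z //= -[_ /(_ 0%N isT)] /= E.
by move: ss0; rewrite -E eqxx.
Qed.

Let meas_path X : cyl_measurable X -> measurable (unit_itv `&` path @^-1` X).
Proof.
(* The sets with measurable preimage form a sigma-algebra, so it suffices to treat cylinders, whose
   preimages are intervals or empty. *)
pose G : set (set (ipath S)) := [set X | measurable (unit_itv `&` path @^-1` X)].
suff : cyl_measurable (S := S) `<=` G by exact.
apply: smallest_sub; last first.
  move=> _ [[s l] _ <-]; rewrite /G /=; have [->|ss0] := eqVneq s s0; last first.
    rewrite (_ : _ `&` _ = set0); first exact: measurable0.
    apply/seteqP; split=> z //= -[_ /(_ 0%N isT)] /= E.
    by move: ss0; rewrite -E eqxx.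
  rewrite (_ : _ `&` _ = unit_itv `&` [set` `[lo l, lo l + len l[%R]).
    by apply: measurableI; exact: measurable_itv.
  apply/seteqP; split=> z /= [/unit_itvP z01 H]; split; try exact/unit_itvP.
    by rewrite in_itv; apply/(cyl_path l z01).
  by apply/cyl_path => //; move: H; rewrite in_itv.
split; rewrite /G /=.
- by rewrite preimage_set0 setI0; exact: measurable0.
- move=> X' mX; rewrite (_ : _ `&` _ = unit_itv `\` (unit_itv `&` path @^-1` X')).
    by apply: measurableD => //; exact: measurable_itv.
  apply/seteqP; split=> z /=; first by move=> [z1 [_ nX]]; split=> // -[].
  by move=> [z1 nX]; split=> //; split=> // Xz; apply: nX.
- move=> F mF; rewrite preimage_bigcup setI_bigcupr; exact: bigcup_measurable.
Qed.

Lemma path_measure_exists : exists P : set (ipath S) -> \bar R,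
  [/\ is_prob_measure P,
      (forall s', P (Cyl (s', [::])) = (if s' == s0 then 1 else 0)%:E)
    & forall w s', P (Cyl (fext w s')) = (P (Cyl w) * (kap w s')%:E)%E].
Proof.
exists law; split.
- split.
  + by rewrite /law preimage_set0 setI0 measure0.
  + by move=> X _; exact: measure_ge0.
  + move=> F mF tF; rewrite /law preimage_bigcup setI_bigcupr.
    apply: (@measure_semi_sigma_additive _ _ _ lebesgue_measure).
    * by move=> n; exact: meas_path.
    * move=> i j _ _ [z [[_ Fi] [_ Fj]]]; apply: (tF i j) => //.
      by exists (path z).
    * by apply: bigcup_measurable => n _; exact: meas_path.
  + rewrite /law preimage_setT setIT lebesgue_measure_itv /= lte_fin ltr01.
    by rewrite -EFinB subr0.
- move=> s'; have [->|ss0] := eqVneq s' s0; first exact: law_cyl.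
  exact: law_cyl0.
- move=> [s l] x; rewrite /fext /=; have [->|ss0] := eqVneq s s0.
    by rewrite !law_cyl len_rcons EFinM.
  by rewrite !law_cyl0// mul0e.
Qed.

End Existence.

Lemma exists_Pr (R : realType) (S A AP : finType) (M : imdp R S A AP) sg pi s :
  is_scheduler sg -> is_nature M pi ->
  exists P : set (ipath S) -> \bar R, is_Pr sg pi s P.
Proof.
move=> Hsg Hpi.
exact: (@path_measure_exists R S (step sg pi) s (fun w => step_dist w Hsg Hpi)).
Qed.

(** * Removing discounts in the limit *)

Section DiscountLimits.
Variable R : realType.

Lemma le_geometric_slack (lam x c : R) : 0 <= lam < 1 ->
  (forall N, x <= c + lam ^+ N) -> x <= c.
Proof.
move=> /andP[l0 l1] H; apply/ler_addgt0Pr => e e0.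
have labs : `|lam| < 1 by rewrite ger0_norm.
have /cvgr0Pnorm_lt/(_ e e0)[N _ /(_ N (leqnn N))] := cvg_expr labs.
rewrite ger0_norm ?exprn_ge0// => /ltW lN.
by apply: le_trans (H N) _; rewrite lerD2l.
Qed.

Lemma bernoulli_ineq (e : R) k : 0 <= e <= 1 -> 1 - k%:R * e <= (1 - e) ^+ k.
Proof.
move=> /andP[e0 e1]; elim: k => [|k IH]; first by rewrite mul0r subr0 expr0.
have k0 : 0 <= (k%:R : R) := ler0n _ _.
rewrite exprS; apply: le_trans (_ : (1 - e) * (1 - k%:R * e) <= _).
  rewrite -natr1; have : 0 <= k%:R * e * e by rewrite !mulr_ge0.
  nra.
by rewrite ler_wpM2l// subr_ge0.
Qed.

Lemma le_discount_limit (k : nat) (v c : R) : 0 <= v <= 1 ->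
  (forall lam, 0 <= lam < 1 -> lam ^+ k * v <= c) -> v <= c.
Proof.
move=> /andP[v0 v1] H; apply/ler_addgt0Pr => e e0.
(* For the discount [1 - e1], the Bernoulli inequality bounds the loss over [k] rounds by
   [k%:R * e1], which is at most [e]. The minimum with [1] keeps the discount nonnegative. *)
pose e1 := Num.min e 1 / k.+1%:R.
have k0 : 0 < (k.+1%:R : R) by rewrite ltr0n.
have m0 : 0 < Num.min e 1 by rewrite lt_min e0 ltr01.
have e10 : 0 < e1 by rewrite divr_gt0.
have e11 : e1 <= 1.
  by rewrite ler_pdivrMr// mul1r ge_min; apply/orP; right; rewrite ler1n.
have ke1 : k%:R * e1 <= e.
  apply: le_trans (_ : k.+1%:R * e1 <= _).
    by rewrite ler_pM2r// ler_nat leqnSn.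
  by rewrite /e1 mulrCA divff ?gt_eqF// mulr1 ge_min lexx.
have h1 : (1 - e1) ^+ k * v <= c by apply: H; rewrite subr_ge0 e11 /= gtrBl.
have h2 : (1 - k%:R * e1) * v <= (1 - e1) ^+ k * v.
  by rewrite ler_wpM2r// bernoulli_ineq// ltW.
have h3 : k%:R * e1 * v <= k%:R * e1 by rewrite ler_piMr// mulr_ge0// ltW.
by rewrite mulrBl mul1r in h2; lra.
Qed.

End DiscountLimits.

(** * Transfer of enforceability between related states *)

Section Transfer.
Variables (R : realType) (S A AP : finType) (M : imdp R S A AP) (Rel : rel S).
Hypotheses (rR : reflexive Rel) (sR : symmetric Rel) (tR : transitive Rel).
Hypothesis bis : forall s t, Rel s t -> bisim_at M Rel s t.

(** The semantics of the probability operator, for an arbitrary path event. *)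
Definition enforces (E : set (ipath S)) (c : cmp) (p : R) (s : S) : Prop :=
  exists pi, is_nature M pi /\ forall sg, is_scheduler sg ->
    forall P, is_Pr sg pi s P -> cmpE c (P E) p%:E.

(** There is no distribution on an empty [A], hence no scheduler, and the condition is vacuous. *)
Lemma enforces_noaction E c p s : (A -> False) -> enforces E c p s.
Proof.
move=> noA; have /choice[pi Hpi] (w : Defs.fpath S) := fam_exists M (flast w).
exists pi; split=> // sg /(_ (s, [::]))[_]; rewrite big1 => [/eqP|a]; last by case: (noA a).
by rewrite eq_sym oner_eq0.
Qed.

Lemma prob_le_up sg s P cls d N (B : aut M) (x : ast B) :
  is_scheduler sg -> cur x = s -> is_Pr sg (aut_nat x) s P ->
  (P [set w | acc cls d N 0 w] <= (up cls d N 0 x)%:E)%E.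
Proof.
move=> Hsg <- HP; rewrite (prob_acc _ _ _ HP) lee_fin.
by have := pval_le_up cls d N 0 ((cur x, [::]) : ast (nat_aut (aut_natP x))) Hsg; rewrite up_aut_nat.
Qed.

Lemma prob_ge_low sg s P cls d N (B : aut M) (x : ast B) :
  is_scheduler sg -> cur x = s -> is_Pr sg (aut_nat x) s P ->
  ((low cls d N 0 x)%:E <= P [set w | acc cls d N 0 w])%E.
Proof.
move=> Hsg <- HP; rewrite (prob_acc _ _ _ HP) lee_fin.
by have := low_le_pval cls d N 0 ((cur x, [::]) : ast (nat_aut (aut_natP x))) Hsg; rewrite low_aut_nat.
Qed.

Section FixedNature.
Variables (pi : Defs.fpath S -> A -> S -> R) (Npi : is_nature M pi) (a0 : A).
Notation B := (nat_aut Npi).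

Lemma prob_eq_up cls d N s : exists sg P,
  [/\ is_scheduler sg, is_Pr sg pi s P &
      P [set w | acc cls d N 0 w] = (up cls d N 0 ((s, [::]) : ast B))%:E].
Proof.
have [sg Hsg E] := up_attained Npi a0 cls d N s.
have [P HP] := exists_Pr s Hsg Npi; exists sg, P; split=> //.
by rewrite (prob_acc _ _ _ HP) E.
Qed.

Lemma prob_eq_low cls d N s : exists sg P,
  [/\ is_scheduler sg, is_Pr sg pi s P &
      P [set w | acc cls d N 0 w] = (low cls d N 0 ((s, [::]) : ast B))%:E].
Proof.
have [sg Hsg E] := low_attained Npi a0 cls d N s.
have [P HP] := exists_Pr s Hsg Npi; exists sg, P; split=> //.
by rewrite (prob_acc _ _ _ HP) E.
Qed.
End FixedNature.

Lemma enforces_acc cls d N c p s t :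
  (forall i s t, Rel s t -> cls i s = cls i t) -> Rel s t ->
  enforces [set w | acc cls d N 0 w] c p s ->
  enforces [set w | acc cls d N 0 w] c p t.
Proof.
move=> inv Rst; case: (pselect (inhabited A)) => [[a0]|noA]; last first.
  by move=> _; apply: enforces_noaction => a; apply: noA.
move=> [pi [Npi H]].
(* Instantiating the hypothesis at schedulers attaining the extrema turns it into a bound on [up] or
   [low] itself, strict where required. *)
have [sgU [PU [sgUs PUP EU]]] := prob_eq_up Npi a0 cls d N s.
have [sgL [PL [sgLs PLP EL]]] := prob_eq_low Npi a0 cls d N s.
have HU := H _ sgUs _ PUP; have HL := H _ sgLs _ PLP.
have [B1 [x1 [c1 H1]]] := sim_up_fin rR sR tR bis inv d N (x := (s, [::]) : ast (nat_aut Npi)) Rst.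
have [B2 [x2 [c2 H2]]] := sim_low_fin rR sR tR bis inv d N (x := (s, [::]) : ast (nat_aut Npi)) Rst.
case: c H HU HL => /= _ HU HL.
- exists (aut_nat x1); split=> [|sg Hsg P HP]; first exact: aut_natP.
  apply: le_trans (prob_le_up _ _ _ Hsg c1 HP) _.
  by apply: le_trans HU; rewrite EU lee_fin.
- exists (aut_nat x1); split=> [|sg Hsg P HP]; first exact: aut_natP.
  apply: le_lt_trans (prob_le_up _ _ _ Hsg c1 HP) _.
  by apply: le_lt_trans HU; rewrite EU lee_fin.
- exists (aut_nat x2); split=> [|sg Hsg P HP]; first exact: aut_natP.
  apply: le_trans (prob_ge_low _ _ _ Hsg c2 HP).
  by apply: le_trans HL _; rewrite EL lee_fin.
- exists (aut_nat x2); split=> [|sg Hsg P HP]; first exact: aut_natP.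
  apply: lt_le_trans (prob_ge_low _ _ _ Hsg c2 HP).
  by apply: lt_le_trans HL _; rewrite EL lee_fin.
Qed.

Section Until.
Variable u : S -> option bool.
Hypothesis u_inv : forall s t, Rel s t -> u s = u t.
Notation reach := (fun N => [set w | acc (fun=> u) false N 0 w]).
Notation until := (\bigcup_N reach N).

Lemma reach_mono N : reach N `<=` reach N.+1.
Proof.
move=> w /=; suff H i : acc (fun=> u) false N i w -> acc (fun=> u) false N.+1 i w by exact: H.
by elim: N i => [//|N IH] i; rewrite [X in X -> _]/= [X in _ -> X]/=; case: (u _) => //=; exact: IH.
Qed.

Lemma meas_until : cyl_measurable until.
Proof. by apply: meas_bigcup => N; exact: meas_acc. Qed.

Lemma prob_until_ge (P : set (ipath S) -> \bar R) N : is_prob_measure P -> (P (reach N) <= P until)%E.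
Proof.
move=> HP; apply: (prob_le HP); first exact: meas_acc.
- exact: meas_until.
- by move=> w Hw; exists N.
Qed.

Lemma prob_until_le (P : set (ipath S) -> \bar R) c : is_prob_measure P ->
  (forall N, (P (reach N) <= c)%E) -> (P until <= c)%E.
Proof.
by move=> HP; apply: (prob_bigcup_le HP) => N; [exact: meas_acc|exact: reach_mono].
Qed.

Lemma aut_enforces_le (B : aut M) (x : ast B) t c : cur x = t ->
  (forall N, up (fun=> u) false N 0 x <= c) -> enforces until CLe c t.
Proof.
move=> cx H; exists (aut_nat x); split=> [|sg Hsg P HP]; first exact: aut_natP.
apply: prob_until_le => [|N]; first by case: HP.
by apply: le_trans (prob_le_up _ _ _ Hsg cx HP) _; rewrite lee_fin.
Qed.

Lemma aut_enforces_ge (B : aut M) (x : ast B) t c : cur x = t ->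
  c <= lowsup u x -> enforces until CGe c t.
Proof.
move=> cx H; exists (aut_nat x); split=> [|sg Hsg P HP]; first exact: aut_natP.
have HPm : is_prob_measure P by case: HP.
rewrite /=; apply: le_trans (_ : (lowsup u x)%:E <= _)%E; first by rewrite lee_fin.
rewrite -(fineK (prob_fin HPm meas_until)) lee_fin; apply: lowsup_le => N.
rewrite -lee_fin fineK; last exact: prob_fin meas_until.
exact: le_trans (prob_ge_low _ _ _ Hsg cx HP) (prob_until_ge _ HPm).
Qed.

Lemma enforces_until_le (a0 : A) p s t : Rel s t ->
  enforces until CLe p s -> enforces until CLe p t.
Proof.
move=> Rst [pi [Npi H]].
have Hs N : up (fun=> u) false N 0 ((s, [::]) : ast (nat_aut Npi)) <= p.
  have [sg [P [Hsg HP E]]] := prob_eq_up Npi a0 (fun=> u) false N s.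
  have HPm : is_prob_measure P by case: HP.
  by rewrite -lee_fin -E; apply: le_trans (prob_until_ge _ HPm) _; exact: H HP.
have [|B [x [cx Hx]]] := sim_up rR sR tR bis (cls := fun=> u) _ (x := ((s, [::]) : ast (nat_aut Npi))) Rst Hs.
  by move=> _; exact: u_inv.
exact: aut_enforces_le Hx.
Qed.

Lemma enforces_until_lt (a0 : A) p s t : Rel s t ->
  enforces until CLt p s -> enforces until CLt p t.
Proof.
move=> Rst [pi [Npi H]].
have /choice[r Hr] (phi : {ffun S -> A}) : exists r, r < p /\ forall N,
    pval (dsched R (fun w => phi (flast w))) pi (fun=> u) false N 0 (s, [::]) <= r.
  set sg := dsched _ _; have Hsg : is_scheduler sg by exact: dsched_scheduler.
  have [P HP] := exists_Pr s Hsg Npi; have HPm : is_prob_measure P by case: HP.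
  have Pfin := prob_fin HPm meas_until.
  exists (fine (P until)); split; first by rewrite -lte_fin fineK//; exact: H HP.
  move=> N; rewrite -lee_fin fineK// -(prob_acc _ _ _ HP); exact: prob_until_ge.
(* Starting the maximum at [p - 1] keeps it below [p]. *)
pose c0 := \big[Order.max/p - 1]_phi r phi.
have c0p : c0 < p.
  by apply: bigmax_lt => [|phi _]; [rewrite gtrBl|case: (Hr phi)].
have Hvi k : vi M u 1 k s <= c0.
  apply: (@le_discount_limit _ k); first by apply: vi01; rewrite ler01 lexx.
  move=> lam /andP[l0 l1]; have l01 : 0 <= lam <= 1 by rewrite l0 ltW.
  (* First [N] tends to infinity for a fixed discount, which removes the loss of the greedy
     scheduler; the discount itself tends to [1] afterwards. *)
  apply: le_trans (vi_discount M u a0 k s l01) _.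
  have [phi Hphi] := vi_sched M u a0 k l01.
  apply: (@le_geometric_slack _ lam); first by rewrite l0.
  move=> N; have := Hphi pi Npi N 0%N (s, [::]); rewrite lerBlDr => /le_trans; apply.
  rewrite lerD2r; apply: le_trans (_ : r phi <= _); first by case: (Hr phi).
  exact: le_bigmax.
(* The midpoint lies strictly above [c0], as nature needs, and strictly below [p]. *)
have [|B [x [cx Hx]]] := @vi_nature R S A AP M u s c0 ((c0 + p) / 2) Hvi; first by lra.
have Rxt : Rel (cur x) t by rewrite cx.
have [|B' [x' [cx' Hx']]] := sim_up rR sR tR bis (cls := fun=> u) _ Rxt Hx.
  by move=> _; exact: u_inv.
have [pi' [Npi' H']] := aut_enforces_le cx' Hx'; exists pi'; split=> // sg Hsg P HP.
by apply: le_lt_trans (H' sg Hsg P HP) _; rewrite lte_fin; lra.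
Qed.

Lemma lowsup_of_prob (a0 : A) pi (Npi : is_nature M pi) s : exists sg P,
  [/\ is_scheduler sg, is_Pr sg pi s P &
      (P until <= (lowsup u ((s, [::]) : ast (nat_aut Npi)))%:E)%E].
Proof.
have [sg Hsg Hle] := lowsup_sched a0 Npi u.
have [P HP] := exists_Pr s Hsg Npi; exists sg, P; split=> //.
apply: prob_until_le => [|N]; first by case: HP.
by rewrite (prob_acc _ _ _ HP) lee_fin.
Qed.

Lemma enforces_until_ge (a0 : A) p s t : Rel s t ->
  enforces until CGe p s -> enforces until CGe p t.
Proof.
move=> Rst [pi [Npi H]].
have [sg [P [Hsg HP Ple]]] := lowsup_of_prob a0 Npi s.
pose x0 : ast (nat_aut Npi) := (s, [::]).
have px0 : p <= lowsup u x0 by rewrite -lee_fin; apply: le_trans Ple; exact: H HP.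
have Vst := optval_inv rR sR tR bis u_inv Rst.
(* Below the value, a nearly optimal automaton at [t] is enough. Otherwise the nature given at [s]
   attains the value, and optimality passes to [t]. *)
have [ltV|geV] := ltP p (optval M u s).
  have [|B [x [cx Hx]]] := @optval_approx R S A AP M u t (optval M u t - p).
    by rewrite subr_gt0 -Vst.
  by apply: (aut_enforces_ge cx); lra.
have [B [x [cx Hx]]] : optimal M u t.
  apply: (optimal_inv a0 rR sR tR bis u_inv _ Rst).
  by exists (nat_aut Npi), x0; split=> //; exact: le_trans px0.
apply: (aut_enforces_ge cx); apply: le_trans Hx; rewrite -Vst.
by apply: le_trans px0 _; exact: (optval_ub u x0).
Qed.

Lemma enforces_until_gt (a0 : A) p s t : Rel s t ->
  enforces until CGt p s -> enforces until CGt p t.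
Proof.
move=> Rst [pi [Npi H]].
have [sg [P [Hsg HP Ple]]] := lowsup_of_prob a0 Npi s.
pose x0 : ast (nat_aut Npi) := (s, [::]).
have px0 : p < lowsup u x0 by rewrite -lte_fin; apply: lt_le_trans Ple; exact: H HP.
(* With the margin above [p] as tolerance, some finite horizon already exceeds [p]. *)
have [|N HN] := @lowsup_approx _ _ _ _ _ u _ x0 (lowsup u x0 - p); first by rewrite subr_gt0.
have [|B [x [cx Hx]]] := sim_low_fin rR sR tR bis (cls := fun=> u) _ false N (x := x0) Rst.
  by move=> _; exact: u_inv.
exists (aut_nat x); split=> [|sg' Hsg' P' HP']; first exact: aut_natP.
have HPm : is_prob_measure P' by case: HP'.
apply: lt_le_trans (prob_until_ge N HPm).
apply: lt_le_trans (prob_ge_low _ _ _ Hsg' cx HP').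
by rewrite lte_fin; lra.
Qed.

Lemma enforces_until c p s t : Rel s t ->
  enforces until c p s -> enforces until c p t.
Proof.
move=> Rst; case: (pselect (inhabited A)) => [[a0]|noA]; last first.
  by move=> _; apply: enforces_noaction => a; apply: noA.
by case: c; [exact: enforces_until_le|exact: enforces_until_lt|
  exact: enforces_until_ge|exact: enforces_until_gt].
Qed.

End Until.
End Transfer.

(** * Path formulas as objectives, and the induction on formulas *)

Section PathFormulas.
Variable S : finType.
Implicit Types (Q : S -> Prop) (w : ipath S).

Definition next_obj Q : objective S :=
  fun i s => if i is 0%N then None else Some `[< Q s >].

Definition until_obj (Q1 Q2 : S -> Prop) (s : S) : option bool :=
  if `[< Q2 s >] then Some true else if `[< Q1 s >] then None else Some false.

Lemma acc_next Q w : acc (next_obj Q) false 2 0 w <-> Q (pos w 2).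
Proof. by rewrite /=; split=> /asboolP. Qed.

(** Times count from [0] and positions from [1]: horizon [k] reads exactly the positions [1] to
    [k]. *)
Lemma acc_until (Q1 Q2 : S -> Prop) k w :
  acc (fun=> until_obj Q1 Q2) false k 0 w <-> bounded_until Q1 Q2 k w.
Proof.
have key i : acc (fun=> until_obj Q1 Q2) false k i w <->
    exists j, [/\ (j < k)%N, Q2 (w (i + j)%N) & forall l, (l < j)%N -> Q1 (w (i + l)%N)].
  elim: k i => [|k IH] i; first by split=> // -[j []].
  rewrite /= [until_obj _ _ _]/until_obj; case: (asboolP (Q2 (w i))) => [q2|nq2] /=.
    by split=> // _; exists 0%N; rewrite addn0.
  case: (asboolP (Q1 (w i))) => [q1|nq1] /=.
    rewrite IH; split=> -[j [jk q2 H]].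
      exists j.+1; rewrite -addSnnS; split=> // -[|l] lj; first by rewrite addn0.
      by rewrite -addSnnS; exact: H.
    case: j jk q2 H => [|j] jk q2 H; first by case: nq2; rewrite addn0 in q2.
    exists j; rewrite addSnnS; split=> // l lj; rewrite addSnnS; exact: H.
  split=> // -[[|j] [jk q2 H]]; first by case: nq2; rewrite addn0 in q2.
  by case: nq1; rewrite -(addn0 i); exact: H.
rewrite key; split=> -[j [jk q2 H]].
  exists j.+1; split=> // -[//|l] /andP[_ lj]; exact: H.
case: j jk q2 H => [//|j] /andP[_ jk] q2 H; exists j; split=> // l lj.
by apply: (H l.+1).
Qed.

End PathFormulas.

Scheme sform_mut := Induction for sform Sort Prop
  with pform_mut := Induction for pform Sort Prop.

Lemma sat_bisim (R : realType) (S A AP : finType) (M : imdp R S A AP)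
    (Rel : rel S) : is_bisim M Rel ->
  forall (phi : sform AP) s t, Rel s t -> sat M phi s <-> sat M phi t.
Proof.
move=> [rR sR tR HR].
have bis s t : Rel s t -> bisim_at M Rel s t by move=> /HR[].
pose inv (Q : S -> Prop) := forall s t, Rel s t -> Q s <-> Q t.
(* For a path formula the induction predicate records the invariance of its immediate state
   subformulas. *)
apply: (@sform_mut AP (fun phi => inv (sat M phi)) (fun psi => match psi with
  | PNext f => inv (sat M f)
  | PUntil f g => inv (sat M f) /\ inv (sat M g)
  | PBUntil f g _ => inv (sat M f) /\ inv (sat M g) end)) => //=.
- by move=> x s t Rst; have [-> _] := HR s t Rst.
- by move=> f IH s t Rst /=; have := IH s t Rst; tauto.
- by move=> f IHf g IHg s t Rst /=; have := IHf s t Rst; have := IHg s t Rst; tauto.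
move=> c p psi IH.
have asb (Q : S -> Prop) s t : inv Q -> Rel s t -> `[< Q s >] = `[< Q t >].
  by move=> iQ Rst; apply: asbool_equiv_eq; exact: iQ.
suff H s t : Rel s t -> enforces M [set w | psat M psi w] c (ratr p) s ->
    enforces M [set w | psat M psi w] c (ratr p) t.
  by move=> s t Rst; split; apply: H => //; rewrite sR.
move=> Rst; case: psi IH => [f iF|f g [iF iG]|f g k [iF iG]].
- rewrite (_ : [set _ | _] = [set w | acc (next_obj (sat M f)) false 2 0 w]); last first.
    by apply/seteqP; split=> w /acc_next.
  apply: (enforces_acc rR sR tR bis) Rst => -[//|i] x y Rxy /=.
  by rewrite (asb _ x y iF).
- rewrite (_ : [set _ | _] = \bigcup_N [set w |
      acc (fun=> until_obj (sat M f) (sat M g)) false N 0 w]); last first.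
    apply/seteqP; split=> w /=; first by move=> [k Hk]; exists k => //; apply/acc_until.
    by move=> [k _ /acc_until Hk]; exists k.
  apply: (enforces_until rR sR tR bis) Rst => x y Rxy.
  by rewrite /until_obj (asb _ x y iF)// (asb _ x y iG).
- rewrite (_ : [set _ | _] = [set w |
      acc (fun=> until_obj (sat M f) (sat M g)) false k 0 w]); last first.
    by apply/seteqP; split=> w /acc_until.
  apply: (enforces_acc rR sR tR bis) Rst => _ x y Rxy.
  by rewrite /until_obj (asb _ x y iF)// (asb _ x y iG).
Qed.

Theorem theorem3 (R : realType) (S A AP : finType) (M : imdp R S A AP)
    (s t : S) :
  bisimilar M s t ->
  forall phi : sform AP, wf_sform phi ->
    (sat M phi s <-> sat M phi t).
Proof. by move=> [Rel [HR Rst]] phi _; exact: sat_bisim HR phi s t Rst. Qed.
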